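(* Let $(\Omega,d,\mu)$ be a locally compact, non-complete metric measure space, with $\mu$ a doubling measure, such that $\Omega$ is a uniform domain in its completion $\overline\Omega$. Suppose also that $\partial\Omega:=\overline\Omega\setminus\Omega$ is equipped with a Borel measure $\nu$ which is codimension $\theta$ Ahlfors regular with respect to $\mu$ for some $\theta>0$. Let $0<\alpha<1$, $1\le p<\infty$, and $1\le q\le\infty$ be such that $0<\alpha-\theta/p<1$. Then there exists a bounded linear trace operator $$T:HB^\alpha_{p,q}(\Omega,\mu)\to HB^{\alpha-\theta/p}_{p,q}(\partial\Omega,\nu)$$ such that for all $u\in HB^\alpha_{p,q}(\Omega,\mu)$ we have $$\lim_{r\to 0^+}\frac{1}{\mu(B(z,r))}\int_{B(z,r)}|u-Tu(z)|^p\,d\mu=0$$ for $\nu$-a.e. $z\in\partial\Omega$, and $$\|Tu\|_{HB^{\alpha-\theta/p}_{p,q}(\partial\Omega,\nu)}\le C\|u\|_{HB^\alpha_{p,q}(\Omega,\mu)},$$ where the constant $C\ge 1$ depends only on $\alpha$, $p$, $q$, and $\theta$, as well as the doubling, codimensional Ahlfors regularity, and uniform domain constants.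
   Context: Doubling: a Borel measure $\mu$ on a metric space is doubling if there is $C_\mu\ge 1$ (the doubling constant) with $0<\mu(B(x,2r))\le C_\mu\,\mu(B(x,r))<\infty$ for all points $x$ and all $r>0$. Boundary: $\overline\Omega$ is the metric completion of $\Omega$; since $\Omega$ is locally compact it is open in $\overline\Omega$. The measure $\mu$ is extended to $\overline\Omega$ by zero (i.e. $\mu(\partial\Omega)=0$). Balls $B(z,r)$ centered at $z\in\partial\Omega$ are balls of $\overline\Omega$. Codimension $\theta$ Ahlfors regularity: $\nu$ is codimension $\theta$ Ahlfors regular with respect to $\mu$ if there is $C_\theta\ge 1$ such that for all $z\in\partial\Omega$ and $0<r\le 2\operatorname{diam}(\partial\Omega)$, $$\frac{1}{C_\theta}\frac{\mu(B(z,r)\cap\Omega)}{r^\theta}\le\nu(B(z,r)\cap\partial\Omega)\le C_\theta\frac{\mu(B(z,r)\cap\Omega)}{r^\theta}.$$ Uniform domain: a curve is a continuous map $\gamma:[a,b]\to X$ (also identified with its image; it need not be rectifiable). A domain (connected open set) $\Omega\subset X$ is $A$-uniform, $A\ge1$, if for every $x,y\in\Omega$ there is a curve $\gamma$ in $\Omega$ joining $x$ to $y$ with (i) $\operatorname{diam}(\gamma)\le A\,d(x,y)$, and (ii) for each $z\in\gamma$, $\min\{\operatorname{diam}(\gamma_{x,z}),\operatorname{diam}(\gamma_{z,y})\}\le A\,\operatorname{dist}(z,X\setminus\Omega)$, where $\gamma_{x,z}$, $\gamma_{z,y}$ are the subcurves of $\gamma$ with the indicated endpoints. It is uniform if it is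 $A$-uniform for some $A\ge 1$; here $X=\overline\Omega$. Besov spaces: for a metric measure space $(X,d,\mu)$, $0<\alpha<1$, $1\le p<\infty$ and $f\in L^1_{\mathrm{loc}}(X,\mu)$, set $$\|f\|_{HB^\alpha_{p,q}(X,\mu)}:=\left(\int_0^\infty\left(\int_X\frac{1}{\mu(B(x,t))}\int_{B(x,t)}|f(y)-f(x)|^p\,d\mu(y)\,d\mu(x)\right)^{q/p}\frac{dt}{t^{\alpha q+1}}\right)^{1/q}$$ for $1\le q<\infty$, and $$\|f\|_{HB^\alpha_{p,\infty}(X,\mu)}:=\sup_{t>0}\frac{1}{t^{\alpha}}\left(\int_X\frac{1}{\mu(B(x,t))}\int_{B(x,t)}|f(y)-f(x)|^p\,d\mu(y)\,d\mu(x)\right)^{1/p}.$$ The homogeneous Besov space $HB^\alpha_{p,q}(X,\mu)$ is the class of $f\in L^1_{\mathrm{loc}}(X,\mu)$ for which this seminorm is finite.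
   Formalization: The boundary ∂Ω is assumed to have positive diameter (at least two points); for a one-point boundary the codimension θ regularity condition is empty and the claim fails, e.g. for the punctured plane with ν a Dirac mass. *)

(* Defs.v *)
From HB Require Import structures.
From mathcomp Require Import all_boot all_order all_algebra.
From mathcomp Require Import all_classical all_reals all_analysis.

Set Implicit Arguments.
Unset Strict Implicit.
Unset Printing Implicit Defensive.

Import Order.TTheory GRing.Theory Num.Theory.
Import numFieldNormedType.Exports.

Local Open Scope classical_set_scope.
Local Open Scope ring_scope.

(* A measurableType must be pointed, a metricType need not be.  The base point
   x0 serves only to meet that requirement: the sigma-algebra of borel x0 is
   generated by the open sets of X and does not depend on x0. *)
Definition based {T : Type} (x0 : T) : Type := T.

HB.instance Definition _ (T : choiceType) (x0 : T) := Choice.on (based x0).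
HB.instance Definition _ (T : choiceType) (x0 : T) :=
  isPointed.Build (based x0) x0.

Definition borel {X : topologicalType} (x0 : X) :=
  g_sigma_algebraType (@open X : set (set (based x0))).

Definition isometry {R : realType} {X Y : metricType R} (f : X -> Y) : Prop :=
  forall x y, mdist (f x) (f y) = mdist x y.

(* cauchy_cvg of completeType, without the pointedness built into cvg. *)
Definition complete_space {R : realType} (X : metricType R) : Prop :=
  forall F : set_system X, ProperFilter F -> cauchy F -> exists x : X, F --> x.

Definition completion_of {R : realType} {X Xbar : metricType R}
    (i : X -> Xbar) : Prop :=
  [/\ complete_space Xbar, isometry i & dense (range i)].

(* Only used for nonempty sets (diam set0 is -oo). *)
Definition diam {R : realType} {X : metricType R} (A : set X) : \bar R :=
  ereal_sup [set (mdist x y)%:E | x in A & y in A].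

Definition distset {R : realType} {X : metricType R} (z : X) (A : set X) :
    \bar R :=
  ereal_inf [set (mdist z w)%:E | w in A].

Definition boundary {R : realType} {X Xbar : metricType R} (i : X -> Xbar) :
  Type := set_type (~` range i).

HB.instance Definition _ (R : realType) (X Xbar : metricType R)
  (i : X -> Xbar) := Choice.on (boundary i).

Definition bdpt {R : realType} {X Xbar : metricType R} {i : X -> Xbar}
  (z : boundary i) : Xbar := \val z.

Section boundary_metric.
Context {R : realType} {X Xbar : metricType R} (i : X -> Xbar).

Let bdist (z w : boundary i) : R := mdist (bdpt z) (bdpt w).

Let bdistxx z : bdist z z = 0.
Proof. exact: mdistxx. Qed.

Let bdist_positivity z w : bdist z w = 0 -> z = w.
Proof. by move=> /mdist_positivity /val_inj. Qed.

Let bdist_sym z w : bdist z w = bdist w z.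
Proof. exact: metric_sym. Qed.

Let bdist_triangle w z v : bdist z v <= bdist z w + bdist w v.
Proof. exact: metric_triangle. Qed.

HB.instance Definition _ := isMetric.Build R (boundary i)
  bdistxx bdist_positivity bdist_sym bdist_triangle.

End boundary_metric.

Definition doubling {R : realType} {X : metricType R} {x0 : X}
    (mu : {measure set (borel x0) -> \bar R}) (C : R) : Prop :=
  forall (x : X) (r : R), 0 < r ->
    [/\ (0 < mu (ball x (2 * r)))%E,
        (mu (ball x (2 * r)) <= C%:E * mu (ball x r))%E
      & (mu (ball x r) < +oo)%E].

(* The subcurves of the curve g on [a, b] with endpoints g a, g t and g t, g b
   are the images of [a, t] and [t, b]. *)
Definition uniform_domain {R : realType} {X : metricType R} (Om : set X)
    (A : R) : Prop :=
  [/\ open Om, connected Om &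
    forall x y, Om x -> Om y ->
      exists (a b : R) (g : R -> X),
        [/\ a <= b, {within `[a, b], continuous g} /\ g @` `[a, b] `<=` Om,
            g a = x /\ g b = y,
            (diam (g @` `[a, b]) <= (A * mdist x y)%:E)%E
          & forall t, a <= t <= b ->
              (Order.min (diam (g @` `[a, t])) (diam (g @` `[t, b]))
                <= A%:E * distset (g t) (~` Om))%E]].

(* For z in the boundary, B(z, r) `&` Omega as a subset of Omega; as mu is
   extended to the completion by zero, its measure is also mu(B(z, r)). *)
Definition bdball {R : realType} {X Xbar : metricType R} {i : X -> Xbar}
    (z : boundary i) (r : R) : set X :=
  i @^-1` ball (bdpt z) r.

(* In the metric space boundary i, ball z r is the intersection of B(z, r)
   with the boundary. *)
Definition codim_regular {R : realType} {X Xbar : metricType R}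
    {i : X -> Xbar} {x0 : X} {z0 : boundary i}
    (mu : {measure set (borel x0) -> \bar R})
    (nu : {measure set (borel z0) -> \bar R}) (theta C : R) : Prop :=
  forall (z : boundary i) (r : R),
    0 < r -> (r%:E <= 2%:E * diam (~` range i))%E ->
    ((C^-1)%:E * (mu (bdball z r) * ((r `^ theta)^-1)%:E)
       <= nu (ball z r))%E /\
    (nu (ball z r)
       <= C%:E * (mu (bdball z r) * ((r `^ theta)^-1)%:E))%E.

Definition locally_integrable_wrt {R : realType} {X : metricType R} {x0 : X}
    (mu : {measure set (borel x0) -> \bar R}) (f : X -> R) : Prop :=
  measurable_fun [set: borel x0] (f : borel x0 -> R) /\
  forall x : X, exists2 r : R, 0 < r &
    mu.-integrable (ball x r) (fun y => (f y)%:E).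

Definition besov_energy {R : realType} {X : metricType R} {x0 : X}
    (mu : {measure set (borel x0) -> \bar R}) (p t : R) (f : X -> R) :
    \bar R :=
  (\int[mu]_x ((mu (ball (x : X) t))^-1 *
     \int[mu]_(y in ball (x : X) t) ((`|f y - f x| `^ p)%:E)))%E.

(* The value at q = -oo is irrelevant: q >= 1 in all uses. *)
Definition besov_norm {R : realType} {X : metricType R} {x0 : X}
    (mu : {measure set (borel x0) -> \bar R}) (alpha p : R) (q : \bar R)
    (f : X -> R) : \bar R :=
  match q with
  | s%:E =>
      ((\int[lebesgue_measure]_(t in `]0%R, +oo[)
          (besov_energy mu p t f `^ (s / p) *
           ((t `^ (alpha * s + 1))^-1)%:E)) `^ s^-1)%E
  | +oo%E =>
      ereal_sup [set (((t `^ alpha)^-1)%:E * besov_energy mu p t f `^ p^-1)%E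
                | t in `]0%R, +oo[]
  | -oo%E => 0%E
  end.

Definition besov {R : realType} {X : metricType R} {x0 : X}
    (mu : {measure set (borel x0) -> \bar R}) (alpha p : R) (q : \bar R) :
    set (X -> R) :=
  [set f | locally_integrable_wrt mu f /\
           (besov_norm mu alpha p q f < +oo)%E].

(* Main.v *)
Require Import Defs.
From HB Require Import structures.
From mathcomp Require Import all_boot all_order all_algebra finmap.
From mathcomp Require Import all_classical all_reals all_analysis.
From mathcomp Require Import measurable_realfun ring lra.

Import Order.TTheory GRing.Theory Num.Theory.
Import numFieldNormedType.Exports.

Local Open Scope classical_set_scope.
Local Open Scope ring_scope.

(** The trace of u at a boundary point z is the limit of the averages of u over
    the parts of B(z, 2 ^ - k) that lie in the space. What makes it exist is that
    the Besov energy is nonlocal: its inner mean at a point x compares u x with u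
    on a whole ball B(x, s). So the p-th power of the difference of the averages of
    u over two balls of size about r near z is at most a constant times the mean
    over x in B(z, r) of the inner mean at scale s = 4 r (average_diff_osc). This
    uses that mu, extended by zero, is doubling around the points of the
    completion (preimage_ball_doubling), and Jensen's inequality up to a constant
    (average_dist_powR).

    Summing these means over the scales t / 2 ^ k, with geometrically growing
    weights, gives a function weighted_osc of z and t. Where it is finite the
    averages converge geometrically, the point is a Lebesgue point whose value is
    the trace (weighted_osc_lebesgue), and the difference of two trace values at
    distance less than t is controlled by weighted_osc at the two points
    (trace_val_hoelder). Tonelli's theorem together with the codimension
    regularity of nu shows that the nu-integral of the mean oscillation at scale r
    is at most a constant times r ^ - theta times the energy of u at scale 4 r
    (integral_mean_osc), which accounts for the loss of theta / p in smoothness.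

    Let E and F be the energies of u and of its trace, as functions of the scale,
    and beta = alpha - theta / p. The two facts combine into
    t ^ (- beta p) F t <= C sum_m 2 ^ (- m delta) H (4 t / 2 ^ m), where
    H s = s ^ (- alpha p) E s and delta = beta p / 2 > 0 (trace_energy_scale).
    The seminorms are norms in L ^ q(dt / t) of the p-th roots of the left-hand
    side and of H, and dt / t is invariant under dilations (integral_dilation), so
    each term of the sum contributes a fixed multiple of 2 ^ (- m delta') for some
    delta' > 0, and these are summable (integral_scale_sum for finite q,
    scale_sup_le for q infinite). A finite seminorm also makes the sum finite at
    some t at most twice the diameter, hence weighted_osc finite almost everywhere on the boundary, which is
    the convergence statement (scale_sum_finite_lebesgue). *)

Set Implicit Arguments.
Unset Strict Implicit.
Unset Printing Implicit Defensive.

(** * Integrals and distances *)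

Section generic.
Context d (T : measurableType d) (R : realType) (mu : {measure set T -> \bar R}).
Local Open Scope ereal_scope.

Import HBNNSimple.

(** The integral of a nonnegative function is a supremum over the simple
    functions below it, so it is monotone without any measurability: integrands
    can be compared before anything is known about their measurability. *)
Lemma ge0_integral_mono (D : set T) (f g : T -> \bar R) :
  (forall x, D x -> 0 <= f x) -> (forall x, D x -> f x <= g x) ->
  \int[mu]_(x in D) f x <= \int[mu]_(x in D) g x.
Proof.
move=> f0 fg; rewrite !ge0_integralE//; last first.
  by move=> x Dx; apply: le_trans (fg x Dx); exact: f0.
apply: ereal_sup_le => _ [h hf <-].
exists h => // x.
apply: le_trans (hf x) _; rewrite /patch; case: ifPn => // xD.
by apply: fg; rewrite inE in xD.
Qed.

End generic.

Section dist_measurable.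
Context (R : realType) (Z : metricType R) (a : nat -> Z).
Hypothesis adense : forall z (e : R), 0 < e -> exists n, mdist z (a n) < e.
Context d1 d2 (S : measurableType d1) (T : measurableType d2).
Variables (phi : S -> Z) (psi : T -> Z).
Hypothesis mphi : forall c, measurable_fun setT (fun s => mdist (phi s) c).
Hypothesis mpsi : forall c, measurable_fun setT (fun s => mdist (psi s) c).

(** The product sigma-algebra is generated by rectangles, hence the detour
    through a dense sequence: d(x, y) < r holds if and only if
    d(x, a n) + d(y, a n) < r for some n, and each of these conditions compares
    a sum of functions of one variable with r. *)
Lemma measurable_mdist :
  measurable_fun setT (fun p : S * T => mdist (phi p.1) (psi p.2)).
Proof.
apply: (measurability _ (RGenInftyO.measurableE R)) => // _ [_ [r ->] <-].
rewrite setTI [X in measurable X](_ : _ = \bigcup_n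
  [set p : S * T | mdist (phi p.1) (a n) + mdist (psi p.2) (a n) < r]).
  apply: bigcup_measurable => n _.
  rewrite -[X in measurable X]setTI.
  rewrite (_ : [set p | _] = (fun p : S * T =>
     (mdist (phi p.1) (a n) + mdist (psi p.2) (a n) < r)%R) @^-1` [set true]) //.
  apply: measurable_fun_ltr => //; apply: measurable_funD.
  - exact: (measurableT_comp (mphi (a n)) measurable_fst).
  - exact: (measurableT_comp (mpsi (a n)) measurable_snd).
apply/seteqP; split => [p /=|p [n _ /=]]; rewrite in_itv/=.
  move=> pr; have e0 : 0 < (r - mdist (phi p.1) (psi p.2)) / 2 by lra.
  have [n hn] := adense (phi p.1) e0; exists n => //=.
  have := metric_triangle (psi p.2) (phi p.1) (a n).
  rewrite (metric_sym (psi p.2) (phi p.1)); lra.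
move=> hn; have := metric_triangle (phi p.1) (a n) (psi p.2).
rewrite (metric_sym (a n)); lra.
Qed.

End dist_measurable.

(** * Metric measure spaces with balls of finite positive measure *)

Lemma ball_mdist (R : realType) (X : metricType R) (x y : X) (r : R) :
  ball x r y = (mdist x y < r) :> Prop.
Proof. by rewrite ballEmdist. Qed.

Lemma subset_mball (R : realType) (X : metricType R) (x y : X) (r s : R) :
  mdist x y + s <= r -> ball y s `<=` ball x r.
Proof.
move=> rs z; rewrite !ball_mdist => yz.
by have := metric_triangle x y z; lra.
Qed.

Section isometry.
Context (R : realType) (X Z : metricType R) (x0 : X) (phi : X -> Z).
Hypothesis iso : Defs.isometry phi.

Lemma isometry_preimage_ball_open (a : Z) (r : R) : open (phi @^-1` ball a r).
Proof.
rewrite openE => x; rewrite /= ball_mdist => ax.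
apply/nbhs_ballP; exists (r - mdist a (phi x)) => /=; first lra.
move=> y; rewrite /= !ball_mdist -iso => xy.
by have := metric_triangle a (phi x) (phi y); lra.
Qed.

Lemma measurable_isometry_preimage_ball (a : Z) (r : R) :
  measurable (phi @^-1` ball a r : set (borel x0)).
Proof. by apply: sub_sigma_algebra; exact: isometry_preimage_ball_open. Qed.

Lemma measurable_isometry_mdist (c : Z) :
  measurable_fun setT (fun x : borel x0 => mdist (phi x) c).
Proof.
apply: (measurability _ (RGenInftyO.measurableE R)) => // _ [_ [r ->] <-].
rewrite setTI (_ : _ @^-1` _ = phi @^-1` ball c r).
  exact: measurable_isometry_preimage_ball.
by apply/seteqP; split => x /=; rewrite in_itv/= ball_mdist metric_sym.
Qed.

Lemma isometry_preimage_ball (x : X) (r : R) :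
  phi @^-1` ball (phi x) r = ball x r.
Proof. by apply/seteqP; split => y; rewrite /= !ball_mdist iso. Qed.

End isometry.

Section borel_metric.
Context (R : realType) (X : metricType R) (x0 : X).

Let idi : Defs.isometry (@id X). Proof. by []. Qed.

Lemma metric_ball_open (x : X) (r : R) : open (ball x r).
Proof. exact: (isometry_preimage_ball_open idi). Qed.

Lemma measurable_metric_ball (x : X) (r : R) :
  measurable (ball x r : set (borel x0)).
Proof. by apply: sub_sigma_algebra; exact: metric_ball_open. Qed.

Lemma measurable_mdist_cst (c : X) :
  measurable_fun setT (fun x : borel x0 => mdist (x : X) c).
Proof. exact: (measurable_isometry_mdist idi). Qed.

End borel_metric.

Definition finite_balls (R : realType) (X : metricType R) (x0 : X)
  (mu : {measure set (borel x0) -> \bar R}) :=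
  forall (x : X) (r : R), 0 < r -> (0 < mu (ball x r) < +oo)%E.

(** At most finitely many sets of a disjoint family inside W have measure at
    least 1 / (n + 1). *)
Lemma countable_disjoint_positive d (T : measurableType d) (R : realType)
    (mu : {measure set T -> \bar R}) (I : choiceType) (E : set I)
    (B : I -> set T) (W : set T) :
  measurable W -> (mu W < +oo)%E -> trivIset E B ->
  (forall i, E i -> [/\ measurable (B i), B i `<=` W & (0 < mu (B i))%E]) ->
  countable E.
Proof.
move=> mW Woo tB EB.
pose En n := [set i | E i /\ ((n.+1%:R^-1)%:E <= mu (B i))%E].
suff -> : E = \bigcup_n En n.
  apply: bigcup_countable => // n _; apply: finite_set_countable.
  apply: contrapT => infE.
  pose N := (Num.truncn (n.+1%:R * fine (mu W))).+1.
  have [F FE NF] := infinite_set_fset N infE.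
  have FEi i : [set` F] i -> E i by move=> /FE[].
  have : (mu (\bigcup_(i in [set` F]) B i) <= mu W)%E.
    apply: le_measure; rewrite ?inE//.
      apply: fin_bigcup_measurable => //= i /FEi/EB[] //.
    by apply: bigcup_sub => i /FEi/EB[].
  rewrite measure_fin_bigcup//; last 2 first.
    exact: sub_trivIset tB.
    by move=> i /FEi/EB[].
  apply/negP; rewrite -ltNge.
  rewrite fsbig_finite//= set_fsetK.
  have: (\sum_(i <- F) (n.+1%:R^-1)%:E <= \sum_(i <- F) mu (B i))%E.
    rewrite big_seq [leRHS]big_seq; apply: lee_sum => i iF.
    by have /FE[] : [set` F] i by [].
  apply: lt_le_trans.
  rewrite sumEFin big_const_seq count_predT iter_addr_0.
  have muW : mu W \is a fin_num by rewrite ge0_fin_numE.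
  rewrite -(fineK muW) lte_fin.
  have n0 : (0 : R) < n.+1%:R by [].
  rewrite -[ltRHS]mulr_natr ltr_pdivlMl//.
  by rewrite (lt_le_trans (truncnS_gt _))// ler_nat.
apply/seteqP; split => [i Ei|i [n _ []]//].
have [_ _ Bi0] := EB i Ei.
have [Bioo|Bioo] := eqVneq (mu (B i)) +oo%E.
  by exists 0%N => //; split=> //; rewrite Bioo leey.
have Bif : mu (B i) \is a fin_num by rewrite ge0_fin_numE// lt_neqAle Bioo leey.
have b0 : 0 < fine (mu (B i)) by rewrite -lte_fin fineK.
exists (Num.truncn (fine (mu (B i)))^-1) => //; split=> //.
rewrite -(fineK Bif) lee_fin -[leRHS]invrK lef_pV2 ?posrE ?invr_gt0//.
exact/ltW/truncnS_gt.
Qed.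

Section separable.
Context (R : realType) (X : metricType R) (x0 : X).
Variable mu : {measure set (borel x0) -> \bar R}.
Hypothesis muB : finite_balls mu.

(** The centres of a maximal disjoint family of balls of radius e k form a
    2 (e k)-net, by maximality. The net is countable because the balls have
    positive measure while bounded parts of the space have finite measure. *)
Lemma finite_balls_separable :
  exists a : nat -> X, forall z (e : R), 0 < e -> exists n, mdist z (a n) < e.
Proof.
pose e (k : nat) : R := k.+1%:R^-1.
have e0 k : 0 < e k by rewrite invr_gt0.
pose M k := ex_maximal_disjoint_subcollection (fun x : X => ball x (e k)) setT.
have tM k : trivIset (sval (M k)) (fun x : X => ball x (e k)).
  by case: (M k) => E /= [].
have maxM k x : exists2 y, sval (M k) y & ball y (e k) `&` ball x (e k) !=set0.
  case: (M k) => E /= [_ tE maxE]; apply: contrapT => nE.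
  have nEx : ~ E x.
    move=> Ex; apply: nE; exists x => //; exists x.
    by split; rewrite ball_mdist mdistxx.
  apply: (maxE (x |` E)) => //.
    by split; [exact: subsetUr | move=> /(_ x) h; apply/nEx/h; left].
  move=> y z [->|Ey] [->|Ez]//.
  - by move=> h; exfalso; apply: nE; exists z => //; rewrite setIC.
  - by move=> h; exfalso; apply: nE; exists y.
  - exact: tE.
have cM : countable (\bigcup_k sval (M k)).
  apply: bigcup_countable => // k _.
  rewrite (_ : sval (M k) = \bigcup_n (sval (M k) `&` ball x0 n.+1%:R)); last first.
    apply/seteqP; split => [x Mx|x [n _ []]//].
    exists (Num.truncn (mdist x0 x)) => //; split=> //=.
    by rewrite ballEmdist/= truncnS_gt.
  apply: bigcup_countable => // n _.
  apply: (@countable_disjoint_positive _ (borel x0) R mu X _ (fun x : X => ball x (e k))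
    (ball x0 (n.+1%:R + e k))).
  - exact: measurable_metric_ball.
  - by have /andP[] := muB x0 (addr_gt0 (ltr0Sn R n) (e0 k)).
  - by apply: sub_trivIset (tM k) => x [].
  - move=> x [Mx xn]; split.
    + exact: measurable_metric_ball.
    + by apply: subset_mball; move: xn; rewrite ball_mdist => xn; rewrite lerD2r ltW.
    + by have /andP[] := muB x (e0 k).
have /(@pcard_surjP (borel x0))[a asur] := cM.
exists a => z r r0.
pose k := Num.truncn (2 / r).
have [y My [w]] := maxM k z.
rewrite /setI/= !ball_mdist => -[yw zw].
have [n _ an] := asur y (ex_intro2 _ _ k I My).
exists n; rewrite an.
have kr : 2 * e k < r.
  by rewrite /e ltr_pdivrMr// mulrC -ltr_pdivrMr// truncnS_gt.
rewrite (metric_sym z).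
by have := metric_triangle y w z; rewrite (metric_sym w z); lra.
Qed.

Lemma finite_balls_sigma_finite : sigma_finite setT mu.
Proof.
exists (fun n => ball x0 n.+1%:R); last first.
  move=> n; split; first exact: measurable_metric_ball.
  by have /andP[] := muB x0 (ltr0Sn R n).
apply/seteqP; split => // x _; exists (Num.truncn (mdist x0 x)) => //.
by rewrite ball_mdist truncnS_gt.
Qed.

End separable.

Section sigma_finite_alias.
Context (R : realType) (X : metricType R) (x0 : X).

(** The sigma-finite structure required by Tonelli's theorem depends on the
    hypothesis on balls, so it is attached to an alias of mu that mentions it. *)
Definition of_finite_balls (mu : {measure set (borel x0) -> \bar R})
  (muB : finite_balls mu) : set (borel x0) -> \bar R := mu.

Context (mu : {measure set (borel x0) -> \bar R}) (muB : finite_balls mu).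

HB.instance Definition _ := Measure.on (of_finite_balls muB).

HB.instance Definition _ := Measure_isSigmaFinite.Build _ _ _
  (of_finite_balls muB) (finite_balls_sigma_finite muB).

End sigma_finite_alias.

Section tonelli_wrappers.
Context (R : realType) (X : metricType R) (x0 : X).
Variable mu : {measure set (borel x0) -> \bar R}.
Hypothesis muB : finite_balls mu.
Context d (T : measurableType d).

Lemma measurable_integral_snd (f : T * borel x0 -> \bar R) :
  measurable_fun setT f -> (forall z, 0 <= f z)%E ->
  measurable_fun setT (fun t => \int[mu]_x f (t, x))%E.
Proof.
move=> mf f0.
exact: (@measurable_fun_fubini_tonelli_F _ _ T (borel x0) R (of_finite_balls muB) f mf f0).
Qed.

End tonelli_wrappers.

Lemma tonelli_swap (R : realType) (X Y : metricType R) (x0 : X) (y0 : Y)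
    (mu : {measure set (borel x0) -> \bar R})
    (nu : {measure set (borel y0) -> \bar R}) (muB : finite_balls mu)
    (nuB : finite_balls nu) (f : borel y0 * borel x0 -> \bar R) :
  measurable_fun setT f -> (forall z, 0 <= f z)%E ->
  (\int[nu]_t \int[mu]_x f (t, x) = \int[mu]_x \int[nu]_t f (t, x))%E.
Proof.
exact: (@fubini_tonelli _ _ (borel y0) (borel x0) R (of_finite_balls nuB)
  (of_finite_balls muB) f).
Qed.

(** * Powers and averages *)

Section powers.
Context (R : realType).
Implicit Types (a b x y p l : R).

Lemma le_powR p x y : 0 <= p -> 0 <= x -> x <= y -> x `^ p <= y `^ p.
Proof.
by move=> p0 x0 xy; apply: ge0_ler_powR; rewrite ?nnegrE// (le_trans x0).
Qed.

Lemma powR_inv_id x p : 0 <= x -> p != 0 -> (x `^ p^-1) `^ p = x.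
Proof. by move=> x0 p0; rewrite -powRrM mulVf// powRr1. Qed.

Lemma powR_id_inv x p : 0 <= x -> p != 0 -> (x `^ p) `^ p^-1 = x.
Proof. by move=> x0 p0; rewrite -powRrM divff// powRr1. Qed.

Lemma powR_add_le a b p : 0 <= p -> 0 <= a -> 0 <= b ->
  (a + b) `^ p <= 2 `^ p * (a `^ p + b `^ p).
Proof.
move=> p0; wlog ab : a b / a <= b.
  move=> H a0 b0; have [|/ltW] := leP a b; first by move/H; apply.
  by move/H => /(_ b0 a0); rewrite (addrC b) (addrC (b `^ p)).
move=> a0 b0; apply: (@le_trans _ _ ((2 * b) `^ p)).
  by apply: le_powR => //; [exact: addr_ge0 | lra].
by rewrite powRM// ler_wpM2l ?powR_ge0// lerDr powR_ge0.
Qed.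

(** Either x <= l, or x / l >= 1 and then x / l <= (x / l) ^ p. *)
Lemma powR_young_crude p l x : 1 <= p -> 0 < l -> 0 <= x ->
  x <= l + l / l `^ p * x `^ p.
Proof.
move=> p1 l0 x0; have lp0 : 0 < l `^ p by rewrite powR_gt0.
have [xl|/ltW lx] := leP x l.
  by rewrite (le_trans xl)// lerDl mulr_ge0 ?powR_ge0// divr_ge0 ?ltW.
rewrite -[leLHS]add0r; apply: lerD; first exact: ltW.
have y1 : 1 <= x / l by rewrite ler_pdivlMr// mul1r.
have yE : x = (x / l) * l by rewrite divfK ?gt_eqF.
have -> : x `^ p = (x / l) `^ p * l `^ p.
  by rewrite -powRM ?divfK ?gt_eqF ?divr_ge0 // ltW.
rewrite [_ * l `^ p]mulrC mulrA divfK ?gt_eqF// {1}yE mulrC ler_pM2l//.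
exact: le1r_powR.
Qed.

End powers.

Section average.
Context d (T : measurableType d) (R : realType) (mu : {measure set T -> \bar R}).
Local Open Scope ereal_scope.

Definition average (A : set T) (h : T -> R) : R :=
  (fine (\int[mu]_(x in A) (h x)%:E) / fine (mu A))%R.

Context (A : set T) (p : R).
Hypotheses (mA : measurable A) (A0 : 0 < mu A < +oo) (p1 : (1 <= p)%R).

Let finA : mu A \is a fin_num.
Proof. by case/andP: A0 => a0 aoo; rewrite ge0_fin_numE// ltW. Qed.

Let pA : (0 < fine (mu A))%R.
Proof. by rewrite -lte_fin fineK//; case/andP: A0. Qed.

Let p0 : (0 <= p)%R. Proof. exact: le_trans p1. Qed.

Lemma inve_measureE : (mu A)^-1 = ((fine (mu A))^-1)%:E.
Proof. by rewrite -{1}(fineK finA) inver gt_eqF. Qed.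

Lemma measurable_dist_powR (h : T -> R) (c : R) : measurable_fun A h ->
  measurable_fun A (fun x => (`|h x - c| `^ p)%R).
Proof.
move=> mh; apply: (@measurableT_comp _ _ _ _ _ _ (fun y : R => (y `^ p)%R)) => //.
by apply: measurableT_comp => //; exact: measurable_funB.
Qed.

Lemma integrable_cst_fin (c : R) : mu.-integrable A (cst c%:E).
Proof.
apply/integrableP; split => //=; rewrite integral_cst//.
by rewrite -(fineK finA) -EFinM ltry.
Qed.

Lemma integrable_of_powR (h : T -> R) (c : R) : measurable_fun A h ->
  \int[mu]_(x in A) (`|h x - c| `^ p)%:E < +oo -> mu.-integrable A (EFin \o h).
Proof.
move=> mh hoo.
have mp := measurable_dist_powR c mh.
have ip : mu.-integrable A (fun x => (`|h x - c| `^ p)%:E).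
  apply/integrableP; split; first exact/measurable_EFinP.
  by under eq_integral do rewrite gee0_abs ?lee_fin ?powR_ge0//.
apply: (@le_integrable _ _ _ mu _ mA _ (cst (`|c| + 1)%R%:E \+ (fun x => (`|h x - c| `^ p)%:E))).
- exact/measurable_EFinP.
- move=> x Ax /=; rewrite lee_fin [leRHS]ger0_norm ?addr_ge0 ?powR_ge0//.
  have := powR_young_crude p1 (@ltr01 R) (normr_ge0 (h x - c)%R).
  rewrite powR1 divr1 mul1r.
  by have := ler_normD (h x - c)%R c; rewrite subrK; lra.
- by apply: integrableD => //; exact: integrable_cst_fin.
Qed.

(** Jensen's inequality up to the factor 2 ^ p. Let J be the mean of
    |h - c| ^ p. Integrating the bound |h - c| <= l + l ^ (1 - p) |h - c| ^ p of
    powR_young_crude gives |average h - c| <= l + l ^ (1 - p) J, which is at most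
    2 l as soon as J <= l ^ p. *)
Lemma average_dist_powR (h : T -> R) (c : R) : measurable_fun A h ->
  (`|average A h - c| `^ p)%:E <=
  (2 `^ p)%:E * ((mu A)^-1 * \int[mu]_(x in A) (`|h x - c| `^ p)%:E).
Proof.
move=> mh; set I := \int[mu]_(x in A) _.
have I0 : 0 <= I by apply: integral_ge0 => x _; rewrite lee_fin powR_ge0.
rewrite inve_measureE.
have [Ioo|Ioo] := eqVneq I +oo.
  by rewrite Ioo !gt0_muley ?leey// lte_fin ?invr_gt0// powR_gt0.
have Ilt : I < +oo by rewrite lt_neqAle Ioo leey.
have ih := integrable_of_powR mh Ilt.
have Ifin : I \is a fin_num by rewrite ge0_fin_numE.
rewrite -(fineK Ifin) -!EFinM lee_fin.
set J := (_^-1 * fine I)%R.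
have J0 : (0 <= J)%R by rewrite mulr_ge0 ?fine_ge0 ?invr_ge0// ltW.
apply/ler_addgt0Pr => e e0.
(* l must be positive, so l ^ p is taken slightly larger than J. *)
pose e' : R := (e / 2 `^ p)%R.
have e'0 : (0 < e')%R by rewrite divr_gt0 ?powR_gt0.
pose l := ((J + e') `^ p^-1)%R.
have l0 : (0 < l)%R by rewrite powR_gt0// ltr_wpDl.
have lp : (l `^ p = J + e')%R by rewrite powR_inv_id ?addr_ge0// ?ltW// gt_eqF ?(lt_le_trans _ p1).
have -> : (2 `^ p * J + e = (2 * l) `^ p)%R.
  by rewrite powRM ?(ltW l0)// lp mulrDr /e' (mulrC _ (e / _)%R) divfK// gt_eqF ?powR_gt0.
apply: le_powR => //.
rewrite -lee_fin.
have -> : (average A h - c = (fine (mu A))^-1 * fine (\int[mu]_(x in A) (h x - c)%:E))%R.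
  rewrite /average.
  have -> : \int[mu]_(x in A) (h x - c)%:E = \int[mu]_(x in A) (h x)%:E - c%:E * mu A.
    rewrite -integral_cst//.
    under eq_integral do rewrite EFinB.
    by rewrite integralB_EFin//; exact: integrable_cst_fin.
  have If := integrable_fin_num mA ih.
  move: If; set I1 := \int[mu]_(x in A) _; move: I1 => I1 If.
  rewrite fineB ?fin_numM// fineM//= mulrBr mulrC; congr (_ - _)%R.
  by rewrite mulrCA mulVf ?mulr1 ?gt_eqF.
have ihc : mu.-integrable A (fun x => (h x - c)%:E).
  under eq_fun do rewrite EFinB.
  by apply: integrableB => //; exact: integrable_cst_fin.
rewrite normrM gtr0_norm ?invr_gt0// EFinM.
have mnh : measurable_fun A (fun x => (`|h x - c|)%:E).
  by apply/measurable_EFinP/measurableT_comp => //; exact: measurable_funB.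
apply: (@le_trans _ _ ((fine (mu A))^-1%:E * \int[mu]_(x in A) (`|h x - c|)%:E)).
  rewrite lee_wpmul2l ?lee_fin ?invr_ge0 ?(ltW pA)//.
  have If := integrable_fin_num mA ihc.
  have := le_abse_integral mu mA (measurable_int _ ihc).
  by rewrite -[X in `|X|](fineK If).
apply: (@le_trans _ _ ((fine (mu A))^-1%:E * \int[mu]_(x in A) (l%:E + (l / l `^ p)%:E * (`|h x - c| `^ p)%:E))).
  rewrite lee_wpmul2l ?lee_fin ?invr_ge0 ?(ltW pA)//.
  apply: ge0_integral_mono => x _; first by rewrite lee_fin.
  by rewrite -EFinM -EFinD lee_fin powR_young_crude.
rewrite ge0_integralD//; last 3 first.
- by move=> *; rewrite lee_fin ltW.
- by move=> *; rewrite -EFinM lee_fin mulr_ge0 ?powR_ge0 ?divr_ge0 ?powR_ge0 ?ltW.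
- by apply: measurable_funeM; apply/measurable_EFinP; exact: measurable_dist_powR.
rewrite integral_cst// ge0_integralZl//; last 2 first.
- by apply/measurable_EFinP; exact: measurable_dist_powR.
- by rewrite lee_fin divr_ge0 ?powR_ge0 ?ltW.
rewrite -/I -(fineK Ifin) -{2}(fineK finA) -(EFinM l) -(EFinM (l / l `^ p)%R) -EFinD -EFinM lee_fin.
have -> : ((fine (mu A))^-1 * (l * fine (mu A) + l / l `^ p * fine I) = l + l / l `^ p * J)%R.
  by rewrite /J; field; rewrite !gt_eqF// powR_gt0.
rewrite mulrDl !mul1r lerD2l -mulrA ger_pMr//.
rewrite mulrC ler_pdivrMr; last exact: powR_gt0.
by rewrite mul1r lp lerDl ltW.
Qed.

End average.

(** * Series and the measure dt/t *)

Section series.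
Context (R : realType).
Local Open Scope ereal_scope.

Lemma le_poweR (x y : \bar R) (s : R) : (0 <= s)%R -> 0 <= x -> x <= y ->
  x `^ s <= y `^ s.
Proof.
move=> s0 x0 xy; apply: gt0_ler_poweR => //.
  by rewrite in_itv/= x0 leey.
by rewrite in_itv/= (le_trans x0 xy) leey.
Qed.

Lemma nneseries_term_le (c : nat -> \bar R) n : (forall m, 0 <= c m) ->
  c n <= \sum_(m <oo) c m.
Proof.
move=> c0; apply: le_trans (nneseries_lim_ge n.+1 _) => //.
by rewrite big_mkord big_ord_recr/= leeDr// sume_ge0.
Qed.

Lemma nneseries_geometric_le (k : R) (c : nat -> \bar R) (M : R) :
  (0 < k < 1)%R -> (forall m, 0 <= c m) -> (forall m, c m <= M%:E) ->
  \sum_(m <oo) (k ^+ m)%:E * c m <= (M / (1 - k))%:E.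
Proof.
move=> /andP[/[dup] kp /ltW k0 k1] c0 cM.
have M0 : (0 <= M)%R by rewrite -lee_fin (le_trans (c0 0%N)).
apply: lime_le.
  by apply: is_cvg_nneseries => n _ _; rewrite mule_ge0 ?lee_fin ?exprn_ge0.
apply: nearW => n; apply: (@le_trans _ _ (\sum_(0 <= m < n) (geometric M k m)%:E)).
  apply: lee_sum => m _; rewrite /geometric/= mulrC EFinM lee_wpmul2l//.
  by rewrite lee_fin exprn_ge0.
rewrite sumEFin lee_fin.
by have := @geometric_le_lim R n M k M0 kp; rewrite ger0_norm//; apply.
Qed.

(** With Y the sum of the c m ^ s, every c m is at most Y ^ (1 / s), so the
    weighted sum is at most Y ^ (1 / s) times a geometric series. The geometric
    weights make one argument serve both s < 1 and s >= 1. *)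
Lemma nneseries_powR_le (k s : R) (c : nat -> \bar R) :
  (0 < k < 1)%R -> (0 < s)%R -> (forall m, 0 <= c m) ->
  (\sum_(m <oo) (k ^+ m)%:E * c m) `^ s <=
  ((1 - k)^-1 `^ s)%:E * \sum_(m <oo) c m `^ s.
Proof.
move=> k01 s0 c0; have /andP[/ltW k0 k1] := k01.
set Y := \sum_(m <oo) c m `^ s.
have Y0 : 0 <= Y by apply: nneseries_ge0 => *; exact: poweR_ge0.
have K0 : (0 < (1 - k)^-1 `^ s)%R by rewrite powR_gt0// invr_gt0; lra.
have [->|Yoo] := eqVneq Y +oo; first by rewrite gt0_muley ?lte_fin ?leey.
have Yfin : Y \is a fin_num by rewrite ge0_fin_numE// lt_neqAle Yoo leey.
pose M := (fine Y `^ s^-1)%R.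
have cM m : c m <= M%:E.
  have -> : c m = (c m `^ s) `^ s^-1 by rewrite -poweRrM divff ?gt_eqF// poweRe1.
  have cY : c m `^ s <= Y.
    by apply: (@nneseries_term_le (fun m => c m `^ s)) => ?; exact: poweR_ge0.
  rewrite /M -poweR_EFin fineK//; apply: le_poweR => //; last exact: poweR_ge0.
  by rewrite invr_ge0 ltW.
have S0 : 0 <= \sum_(m <oo) (k ^+ m)%:E * c m.
  by apply: nneseries_ge0 => *; rewrite mule_ge0 ?lee_fin ?exprn_ge0.
apply: le_trans (le_poweR (ltW s0) S0 (nneseries_geometric_le k01 c0 cM)) _.
rewrite poweR_EFin powRM ?powR_ge0 ?invr_ge0//; last lra.
by rewrite -powRrM mulVf ?gt_eqF// powRr1 ?fine_ge0// EFinM fineK// muleC.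
Qed.

Lemma measurable_poweR (s : R) : measurable_fun setT (fun x : \bar R => x `^ s).
Proof.
rewrite (_ : (fun _ => _) = (fun x : \bar R => if s == 0%R then
                (if x \is a fin_num then fine x `^ s else 1)%:E
               else if x == +oo then +oo
                    else if x == -oo then 0 else (fine x `^ s)%:E)); last first.
  by apply/funext => x; rewrite poweRE.
have mP : measurable_fun setT (fun x : \bar R => (fine x `^ s)%:E).
  apply/measurable_EFinP.
  exact: (@measurableT_comp _ _ _ _ _ _ (fun y : R => (y `^ s)%R)).
have me (y : \bar R) : measurable_fun setT (fun x : \bar R => x == y).
  apply: (@measurable_fun_bool _ _ _ _ true) => //.
  rewrite setTI (_ : _ @^-1` _ = [set y])//.
  by apply/seteqP; split => x /= /eqP.
case: (s == 0%R); last by do ! apply: measurable_fun_ifT => //.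
apply/measurable_EFinP/measurable_fun_ifT => //; last exact/measurable_EFinP.
apply: (@measurable_fun_bool _ _ _ _ true) => //.
rewrite setTI (_ : _ @^-1` _ = EFin @` setT); first (apply: measurable_image_EFin; exact: (@measurableT _ (measurableTypeR R))).
apply/seteqP; split => [x /= xf|_ [r _ <-]//].
by exists (fine x) => //; rewrite fineK.
Qed.

End series.

Section scaling.
Context (R : realType).
Local Open Scope ereal_scope.
Local Notation mu := (@lebesgue_measure R).

(** The measure dt / t is invariant under dilations: Lebesgue measure is c times
    its image under t |-> c t. *)
Lemma integral_dilation (c : R) (h : R -> \bar R) : (0 < c)%R ->
  measurable_fun setT h -> (forall t, 0 <= h t) ->
  \int[mu]_(t in `]0%R, +oo[) (h (c * t)%R * (t^-1)%:E) =
  \int[mu]_(t in `]0%R, +oo[) (h t * (t^-1)%:E).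
Proof.
move=> c0 mh h0.
pose phi : measurableTypeR R -> measurableTypeR R := fun t => (c * t)%R.
have mphi : measurable_fun setT phi by exact: measurable_funM.
pose m0 : {measure set (measurableTypeR R) -> \bar R} :=
  mscale (NngNum (ltW c0)) (pushforward mu phi).
pose m := m0 mphi.
have mE A : measurable A -> mu A = m A.
  apply: lebesgue_measure_unique => _ [[a b]] _ <-.
  rewrite /m /= /mscale/= /pushforward.
  rewrite (_ : phi @^-1` _ = `](a / c)%R, (b / c)%R]%classic); last first.
    apply/seteqP; split => t /=; rewrite !in_itv/= /phi ltr_pdivrMr// ler_pdivlMr// (mulrC t)//.
  rewrite !lebesgue_measure_itv/= !lte_fin ltr_pM2r ?invr_gt0//.
  case: ifP => _; last by rewrite mule0.
  by rewrite -!EFinB -EFinM -mulrBl mulrC divfK// gt_eqF.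
rewrite [RHS](eq_measure_integral m)//=; last by move=> A mA _; exact: mE.
have mV : measurable_fun (`]0%R, +oo[%classic : set R) (fun t : R => (t^-1)%R).
  apply: open_continuous_measurable_fun => // t; rewrite inE/= in_itv/= andbT => t0.
  by apply: inv_continuous; rewrite gt_eqF.
have mf : measurable_fun (`]0%R, +oo[%classic : set (measurableTypeR R)) (fun t : R => h t * (t^-1)%:E).
  apply: emeasurable_funM; first exact: measurable_funTS.
  exact/measurable_EFinP.
have f0 t : `]0%R, +oo[%classic t -> 0 <= h t * (t^-1)%:E.
  rewrite /= in_itv/= andbT => t0.
  by rewrite mule_ge0// lee_fin invr_ge0 ltW.
rewrite ge0_integral_mscale//= ge0_integral_pushforward//; last first.
  by move=> t /set_mem; exact: f0.
rewrite (_ : phi @^-1` _ = `]0%R, +oo[%classic); last first.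
  by apply/seteqP; split => t /=; rewrite !in_itv/= !andbT /phi pmulr_rgt0.
rewrite -ge0_integralZl//; last 3 first.
- rewrite (_ : _ \o _ = fun t : measurableTypeR R => h (phi t) * (c^-1 * t^-1)%:E); last first.
    by apply/funext => t /=; rewrite /phi invfM.
  apply: emeasurable_funM; first by apply: measurable_funTS; exact: measurableT_comp.
  by apply/measurable_EFinP/measurable_funM.
- by move=> t; rewrite /= in_itv/= andbT => t0; apply: f0; rewrite /= in_itv/= andbT mulr_gt0.
- by rewrite lee_fin ltW.
apply: eq_integral => t _ /=; rewrite /phi invfM muleCA EFinM (muleA c%:E).
by rewrite -EFinM divff ?gt_eqF// div1r.
Qed.

End scaling.

(** * A doubling measure extended by zero to the completion *)

Section doubling_extension.
Context (R : realType) (X Z : metricType R) (x0 : X) (iota : X -> Z).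
Variables (mu : {measure set (borel x0) -> \bar R}) (Cmu : R).
Hypotheses (iso : Defs.isometry iota) (dns : dense (range iota)).
Hypotheses (dbl : doubling mu Cmu) (Cmu1 : 1 <= Cmu).

Local Notation D a r := (iota @^-1` ball a r).

Lemma doubling_finite_balls : finite_balls mu.
Proof.
move=> x r r0; have [_ _ ->] := dbl x r0; rewrite andbT.
have r20 : 0 < r / 2 by rewrite divr_gt0.
by have [+ _ _] := dbl x r20; rewrite mulrC divfK.
Qed.

Lemma doubling_iter n (x : X) (r : R) : 0 < r ->
  (mu (ball x (2 ^+ n * r)) <= (Cmu ^+ n)%:E * mu (ball x r))%E.
Proof.
move=> r0; elim: n => [|n IH]; first by rewrite !expr0 mul1r mul1e.
rewrite !exprS -mulrA EFinM -muleA.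
have [_ h _] := dbl x (mulr_gt0 (exprn_gt0 n (ltr0n R 2)) r0).
by apply: le_trans h _; rewrite lee_wpmul2l// lee_fin (le_trans _ Cmu1).
Qed.

Lemma dense_near (a : Z) (e : R) : 0 < e -> exists x, mdist a (iota x) < e.
Proof.
move=> e0; have [|z [az [x _ xz]]] := dns _ (metric_ball_open a e).
  by exists a; rewrite ball_mdist mdistxx.
by exists x; rewrite xz -ball_mdist.
Qed.

Lemma preimage_ball_sub (a b : Z) (s r : R) : mdist a b + s <= r ->
  D b s `<=` D a r.
Proof. by move=> h x; exact: (subset_mball h). Qed.

Lemma measurable_preimage_ball a r : measurable (D a r : set (borel x0)).
Proof. exact: measurable_isometry_preimage_ball. Qed.

Lemma preimage_ball_gt0 a (r : R) : 0 < r -> (0 < mu (D a r) < +oo)%E.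
Proof.
move=> r0; have [x ax] := dense_near a (divr_gt0 r0 (ltr0n R 2)).
apply/andP; split.
  have /andP[h _] := doubling_finite_balls x (divr_gt0 r0 (ltr0n R 2)).
  apply: (lt_le_trans h); apply: le_measure; rewrite ?inE.
  - exact: measurable_metric_ball.
  - exact: measurable_preimage_ball.
  - rewrite -(isometry_preimage_ball iso); apply: preimage_ball_sub; lra.
have r20 : 0 < 2 * r by lra.
have /andP[_ h] := doubling_finite_balls x r20.
apply: (le_lt_trans _ h); apply: le_measure; rewrite ?inE.
- exact: measurable_preimage_ball.
- exact: measurable_metric_ball.
- rewrite -(isometry_preimage_ball iso); apply: preimage_ball_sub.
  rewrite metric_sym; lra.
Qed.

(** By density the ball of centre b and radius r contains the ball of radius
    r / 2 around some point of X. The latter ball, enlarged 2 ^ 5 times, has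
    radius 16 r and contains the ball of centre a and radius s. Hence mu, extended
    by zero, is doubling around every point of the completion. *)
Lemma preimage_ball_doubling a b (s r : R) : 0 < r -> mdist a b + s <= 15 * r ->
  (mu (D a s) <= (Cmu ^+ 5)%:E * mu (D b r))%E.
Proof.
move=> r0 h; have r20 : 0 < r / 2 by rewrite divr_gt0.
have [x bx] := dense_near b r20.
apply: (@le_trans _ _ (mu (ball x (2 ^+ 5 * (r / 2))))).
  apply: le_measure; rewrite ?inE.
  - exact: measurable_preimage_ball.
  - exact: measurable_metric_ball.
  - rewrite -(isometry_preimage_ball iso); apply: preimage_ball_sub.
    have := metric_triangle (iota x) b a.
    have e32 : (2 : R) ^+ 5 = 32 by rewrite -natrX.
    rewrite (metric_sym (iota x) b) (metric_sym b a) e32; lra.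
apply: (le_trans (doubling_iter 5 x r20)).
rewrite lee_wpmul2l ?lee_fin ?exprn_ge0 ?(le_trans _ Cmu1)//.
apply: le_measure; rewrite ?inE.
- exact: measurable_metric_ball.
- exact: measurable_preimage_ball.
- rewrite -(isometry_preimage_ball iso); apply: preimage_ball_sub; lra.
Qed.

Lemma completion_separable :
  exists a : nat -> Z, forall z (e : R), 0 < e -> exists n, mdist z (a n) < e.
Proof.
have [a ha] := finite_balls_separable doubling_finite_balls.
exists (iota \o a) => z e e0; have e20 : 0 < e / 2 by rewrite divr_gt0.
have [x zx] := dense_near z e20; have [n xn] := ha x _ e20.
by exists n => /=; have := metric_triangle z (iota x) (iota (a n)); rewrite iso; lra.
Qed.

End doubling_extension.

(** * Measurability of ball averages *)

Section kernel.
Context (R : realType) (X Z : metricType R) (x0 : X).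
Variables (mu : {measure set (borel x0) -> \bar R}) (muB : finite_balls mu).
Variable a : nat -> Z.
Hypothesis adense : forall z (e : R), 0 < e -> exists n, mdist z (a n) < e.
Context d (T : measurableType d).
Variables (phi : T -> Z) (psi : X -> Z) (rho : T -> R).
Hypothesis mphi : forall c, measurable_fun setT (fun s => mdist (phi s) c).
Hypothesis isopsi : Defs.isometry psi.
Hypothesis mrho : measurable_fun setT rho.
Local Open Scope ereal_scope.

Local Notation B t := (psi @^-1` ball (phi t) (rho t)).

(** The ball depends on t; writing it as the condition d(phi t, psi y) < rho t on
    the pair (t, y) brings the integral under Tonelli's theorem. *)
Lemma measurable_kernel_integral (h : T * borel x0 -> \bar R) :
  measurable_fun setT h -> (forall z, 0 <= h z) ->
  measurable_fun setT (fun t => \int[mu]_(y in B t) h (t, y)).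
Proof.
move=> mh h0.
pose k (q : T * borel x0) :=
  if (mdist (phi q.1) (psi q.2) < rho q.1)%R then h q else 0.
have mk : measurable_fun setT k.
  apply: measurable_fun_ifT => //; apply: measurable_fun_ltr.
    apply: (measurable_mdist adense mphi) => c.
    exact: measurable_isometry_mdist.
  exact: (measurableT_comp mrho measurable_fst).
have k0 q : 0 <= k q by rewrite /k; case: ifP.
rewrite (_ : (fun _ => _) = (fun t => \int[mu]_y k (t, y))).
  exact: measurable_integral_snd.
apply/funext => t; rewrite integral_mkcond; apply: eq_integral => y _.
rewrite /patch /k/=; case: ifPn => [|].
  by rewrite inE/= ball_mdist => ->.
by rewrite notin_setE/= ball_mdist => /negP/negbTE ->.
Qed.

(** If rho t <= 0 the ball is empty and the inverse is +oo; otherwise the measure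
    is a positive real number, whose inverse is a real power. *)
Lemma measurable_kernel_inve :
  (forall t, (0 < rho t)%R -> 0 < mu (B t) < +oo) ->
  measurable_fun setT (fun t => (mu (B t))^-1).
Proof.
move=> muB0.
have mB t : measurable (B t : set (borel x0)).
  exact: measurable_isometry_preimage_ball.
have m1 : measurable_fun setT (fun t => mu (B t)).
  rewrite (_ : (fun _ => _) = (fun t => \int[mu]_(y in B t) (cst 1) (t, y))).
    exact: measurable_kernel_integral.
  by apply/funext => t; rewrite integral_cst// mul1e.
rewrite (_ : (fun _ => _) = (fun t =>
   if (0 < rho t)%R then (fine (mu (B t)) `^ (-1))%:E else +oo)).
  apply: measurable_fun_ifT => //; first exact: measurable_fun_ltr.
  apply/measurable_EFinP.
  apply: (@measurableT_comp _ _ _ _ _ _ (fun y : R => (y `^ (-1))%R)) => //.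
  exact: measurableT_comp.
apply/funext => t; case: ifPn => [|]; first by move/muB0/inve_measureE ->; rewrite powR_inv1// fine_ge0.
rewrite -leNgt => r0; rewrite (_ : B t = set0) ?measure0 ?inve0//.
apply/seteqP; split => // x; rewrite /= ball_mdist => h.
by have := mdist_ge0 (phi t) (psi x); lra.
Qed.

End kernel.

Section oscillation.
Context (R : realType) (X : metricType R) (x0 : X).
Variables (mu : {measure set (borel x0) -> \bar R}) (muB : finite_balls mu).
Variables (p : R) (u : X -> R).
Hypothesis meas_u : measurable_fun [set: borel x0] (u : borel x0 -> R).
Local Open Scope ereal_scope.

Definition local_osc (s : R) (x : X) : \bar R :=
  (mu (ball x s))^-1 * \int[mu]_(y in ball x s) ((`|u y - u x| `^ p)%:E).

Lemma besov_energyE t : besov_energy mu p t u = \int[mu]_x local_osc t x.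
Proof. by []. Qed.

Lemma local_osc_ge0 s x : 0 <= local_osc s x.
Proof.
by rewrite mule_ge0 ?inve_ge0// integral_ge0// => y _; rewrite lee_fin powR_ge0.
Qed.

Lemma besov_energy_ge0 t : 0 <= besov_energy mu p t u.
Proof. by apply: integral_ge0 => x _; exact: local_osc_ge0. Qed.

(** Joint measurability in the radius and the centre serves twice: for the
    integral over the centre, and for the energy as a function of the radius. *)
Lemma measurable_local_osc2 :
  measurable_fun setT (fun q : R * borel x0 => local_osc q.1 q.2).
Proof.
have [a adense] := finite_balls_separable muB.
have m1 (c : X) : measurable_fun setT (fun q : R * borel x0 => mdist (q.2 : X) c).
  exact: (measurableT_comp (measurable_mdist_cst c) measurable_snd).
have iid : Defs.isometry (@id X) by [].
apply: emeasurable_funM.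
  apply: (measurable_kernel_inve muB adense m1 iid measurable_fst) => q r0.
  exact: muB.
pose h (q : R * borel x0 * borel x0) := ((`|u q.2 - u q.1.2| `^ p)%:E).
apply: (measurable_kernel_integral muB adense m1 iid measurable_fst (h := h)).
  apply/measurable_EFinP.
  apply: (@measurableT_comp _ _ _ _ _ _ (fun y : R => (y `^ p)%R)) => //.
  apply: measurableT_comp => //; apply: measurable_funB.
    exact: (measurableT_comp meas_u measurable_snd).
  exact: (measurableT_comp meas_u (measurableT_comp measurable_snd measurable_fst)).
by move=> z; rewrite lee_fin powR_ge0.
Qed.

Lemma measurable_local_osc s : measurable_fun [set: borel x0] (local_osc s).
Proof.
exact: (measurableT_comp measurable_local_osc2 (pair1_measurable s)).
Qed.

Lemma measurable_besov_energy :
  measurable_fun setT (fun t => besov_energy mu p t u).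
Proof.
apply: (measurable_integral_snd muB measurable_local_osc2) => q.
exact: local_osc_ge0.
Qed.

End oscillation.

(** * Telescoping sums *)

Section telescoping.
Context (R : realType).

(** With e k = M l ^ k / (1 - l), the sum of all steps from k on, x k - e k is
    nondecreasing and x k + e k is nonincreasing; L is the supremum of the
    former. *)
Lemma geometric_steps_limit (x : nat -> R) (M l : R) : 0 <= M -> 0 < l < 1 ->
  (forall k, `|x k - x k.+1| <= M * l ^+ k) ->
  exists L, forall k, `|x k - L| <= M / (1 - l) * l ^+ k.
Proof.
move=> M0 /andP[l0 l1] xM; have l10 : 0 < 1 - l by lra.
pose e k := M / (1 - l) * l ^+ k.
have e0 k : 0 <= e k by rewrite mulr_ge0 ?exprn_ge0 ?divr_ge0// ltW.
have eS k : e k.+1 = e k - M * l ^+ k.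
  by rewrite /e exprS; field; rewrite gt_eqF.
have lo k : x k - e k <= x k.+1 - e k.+1.
  by have := xM k; rewrite eS ler_norml => /andP[]; lra.
have up k : x k.+1 + e k.+1 <= x k + e k.
  by have := xM k; rewrite eS ler_norml => /andP[]; lra.
have lo_le i j : (i <= j)%N -> x i - e i <= x j - e j.
  elim: j => [|j IH]; first by rewrite leqn0 => /eqP->.
  by rewrite leq_eqVlt => /predU1P[->//|/IH h]; exact: le_trans h _.
have up_le i j : (i <= j)%N -> x j + e j <= x i + e i.
  elim: j => [|j IH]; first by rewrite leqn0 => /eqP->.
  by rewrite leq_eqVlt => /predU1P[->//|/IH h]; exact: le_trans h.
have lu i j : x i - e i <= x j + e j.
  have := lo_le _ _ (leq_maxl i j); have := up_le _ _ (leq_maxr i j).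
  have := e0 (maxn i j); lra.
exists (sup (range (fun k => x k - e k))) => k.
have S0 : range (fun k => x k - e k) !=set0 by exists (x 0%N - e 0%N), 0%N.
have h1 : x k - e k <= sup (range (fun k => x k - e k)).
  by apply: ub_le_sup => //; exists (x k + e k) => _ [i _ <-].
have h2 : sup (range (fun k => x k - e k)) <= x k + e k.
  by apply: ge_sup => // _ [i _ <-].
by rewrite -/(e k) ler_norml; apply/andP; split; lra.
Qed.

Lemma dyadic_scale (t r : R) : 0 < r <= t ->
  exists j, t / 2 ^+ j.+1 < r <= t / 2 ^+ j.
Proof.
move=> /andP[r0 rt].
have [n tn] : exists n, t / 2 ^+ n.+1 < r.
  exists (Num.truncn (t / r)).
  rewrite ltr_pdivrMr ?exprn_gt0// mulrC -ltr_pdivrMr//.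
  apply: (lt_le_trans (truncnS_gt _)).
  by rewrite -natrX ler_nat ltnW// ltn_expl.
have ex : exists n, t / 2 ^+ n.+1 < r by exists n.
case: (ex_minnP ex) => j tj jmin; exists j; rewrite tj/=.
case: j tj jmin => [|j] tj jmin; first by rewrite expr0 divr1.
by rewrite leNgt; apply/negP => /jmin; rewrite ltnn.
Qed.

End telescoping.

Section lower_average.
Context d (T : measurableType d) (R : realType) (mu : {measure set T -> \bar R}).
Local Open Scope ereal_scope.

Lemma le_average_integral (A : set T) (g : T -> \bar R) (c k : R) :
  measurable A -> 0 < mu A < +oo -> measurable_fun A g -> (forall x, 0 <= g x) ->
  (0 <= k)%R -> (0 <= c)%R ->
  (forall x, A x -> c%:E <= k%:E * g x) ->
  c%:E <= k%:E * ((mu A)^-1 * \int[mu]_(x in A) g x).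
Proof.
move=> mA A0 mg g0 k0 c0 cg.
have : \int[mu]_(x in A) c%:E <= \int[mu]_(x in A) (k%:E * g x).
  by apply: ge0_integral_mono.
rewrite integral_cst// ge0_integralZl// => h.
rewrite inve_measureE//.
have finA : mu A \is a fin_num.
  by case/andP: A0 => a0 aoo; rewrite ge0_fin_numE// ltW.
have pA : (0 < fine (mu A))%R by rewrite -lte_fin fineK//; case/andP: A0.
rewrite -(fineK finA) in h.
rewrite muleCA; apply: (le_trans _ (lee_wpmul2l _ h)).
  by rewrite -!EFinM mulrCA mulVf ?mulr1 ?gt_eqF.
by rewrite lee_fin invr_ge0 ltW.
Qed.

End lower_average.

(** * Oscillation of averages near the boundary *)

Section local_estimates.
Context (R : realType) (X Z : metricType R) (x0 : X) (iota : X -> Z).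
Variables (mu : {measure set (borel x0) -> \bar R}) (Cmu p : R).
Hypotheses (iso : Defs.isometry iota) (dns : dense (range iota)).
Hypotheses (dbl : doubling mu Cmu) (Cmu1 : 1 <= Cmu) (p1 : 1 <= p).
Variable u : X -> R.
Hypothesis meas_u : measurable_fun [set: borel x0] (u : borel x0 -> R).
Local Open Scope ereal_scope.

Local Notation D a r := (iota @^-1` ball a r).

Let muB : finite_balls mu := doubling_finite_balls dbl.
Let p0 : (0 <= p)%R. Proof. exact: le_trans p1. Qed.
Let mD a r : measurable (D a r : set (borel x0)) :=
  measurable_preimage_ball iso a r.
Let D0 a r (r0 : (0 < r)%R) : 0 < mu (D a r) < +oo :=
  preimage_ball_gt0 iso dns dbl a r0.

Definition trace_avg (z : Z) (r : R) : R := average mu (D z r) u.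

(** The radius 4 r is large enough for the ball B(x, 4 r) around a point x of
    B(z, r) to contain every B(w, r') with d(z, w) < r and r' <= r: this single
    quantity controls all averages near z at scale r. *)
Definition mean_osc (z : Z) (r : R) : \bar R :=
  (mu (D z r))^-1 * \int[mu]_(x in D z r) local_osc mu p u (4 * r) x.

Definition mean_dist (z : Z) (r L : R) : \bar R :=
  (mu (D z r))^-1 * \int[mu]_(x in D z r) ((`|u x - L| `^ p)%:E).

Definition k_osc : R := (2 `^ p * Cmu ^+ 5)%R.
Definition k_avg : R := (2 `^ p * (2 * k_osc))%R.

Let K0 : (0 < Cmu ^+ 5)%R. Proof. by rewrite exprn_gt0// (lt_le_trans _ Cmu1). Qed.
Let tp0 : (0 < 2 `^ p :> R)%R. Proof. by rewrite powR_gt0. Qed.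
Lemma k_osc_gt0 : (0 < k_osc)%R. Proof. by rewrite mulr_gt0. Qed.
Lemma k_avg_gt0 : (0 < k_avg)%R.
Proof. by apply: mulr_gt0 => //; apply: mulr_gt0 => //; exact: k_osc_gt0. Qed.

Lemma mean_osc_ge0 z r : 0 <= mean_osc z r.
Proof.
rewrite mule_ge0 ?inve_ge0// integral_ge0// => x _; exact: local_osc_ge0.
Qed.

Lemma mean_dist_ge0 z r L : 0 <= mean_dist z r L.
Proof.
by rewrite mule_ge0 ?inve_ge0// integral_ge0// => x _; rewrite lee_fin powR_ge0.
Qed.

Lemma measurable_u A : measurable_fun (A : set (borel x0)) (u : borel x0 -> R).
Proof. exact: measurable_funTS. Qed.

Lemma measurable_udist A L : measurable_fun (A : set (borel x0))
  (fun x => (`|u x - L| `^ p)%:E).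
Proof. by apply/measurable_EFinP/measurable_dist_powR; exact: measurable_u. Qed.

Lemma mean_integral_le (A B : set (borel x0)) (f : X -> \bar R) (k : R) :
  measurable A -> measurable B -> A `<=` B -> (0 < k)%R ->
  0 < mu A < +oo -> 0 < mu B < +oo -> mu B <= k%:E * mu A ->
  (forall x, 0 <= f x) ->
  (mu A)^-1 * \int[mu]_(x in A) f x <= k%:E * ((mu B)^-1 * \int[mu]_(x in B) f x).
Proof.
move=> mA mB AB k0 A0 B0 BA f0.
have fin C : 0 < mu C < +oo -> mu C \is a fin_num /\ (0 < fine (mu C))%R.
  move=> /andP[c0 coo]; have fC : mu C \is a fin_num by rewrite ge0_fin_numE// ltW.
  by split=> //; rewrite -lte_fin fineK.
have [fA pA] := fin _ A0; have [fB pB] := fin _ B0.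
rewrite !inve_measureE// muleA -EFinM.
apply: lee_pmul; rewrite ?lee_fin ?invr_ge0 ?fine_ge0//.
- by apply: integral_ge0.
- move: BA; rewrite -(fineK fA) -(fineK fB) -EFinM lee_fin => BA.
  rewrite ler_pdivlMr// mulrC ler_pdivrMr//.
rewrite (integral_mkcond A) (integral_mkcond B).
apply: ge0_integral_mono => x _; first by apply: erestrict_ge0.
rewrite /patch; case: ifPn => xA; last by case: ifPn.
by rewrite ifT// inE; apply: AB; rewrite inE in xA.
Qed.

(** The ball B(w, r') lies in B(x, 4 r) and has comparable measure, so the mean
    of |u - u x| ^ p over it is at most a constant times local_osc (4 r) x;
    average_dist_powR then passes to the average of u. *)
Lemma osc_average z w (r r' : R) (x : X) :
  (0 < r)%R -> (r / 2 <= r' <= r)%R -> (mdist z w < r)%R -> D z r x ->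
  (`|u x - trace_avg w r'| `^ p)%:E <= k_osc%:E * local_osc mu p u (4 * r) x.
Proof.
move=> r0 /andP[rr' r'r] zw zx.
have r'0 : (0 < r')%R by lra.
rewrite distrC.
have h := @average_dist_powR _ (borel x0) R mu (D w r') p (mD w r')
  (D0 w r'0) p1 u (u x) (@measurable_u (D w r')).
apply: (le_trans h).
rewrite /k_osc EFinM -muleA lee_wpmul2l// /local_osc.
rewrite /= ball_mdist in zx.
have xw : (mdist (iota x) w < 2 * r)%R.
  by have := metric_triangle (iota x) z w; rewrite (metric_sym _ z); lra.
apply: mean_integral_le => //.
- exact: measurable_metric_ball.
- by rewrite -(isometry_preimage_ball iso); apply: preimage_ball_sub; lra.
- exact: D0.
- by apply: muB; lra.
- rewrite -(isometry_preimage_ball iso).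
  by apply: (preimage_ball_doubling iso dns dbl Cmu1); lra.
Qed.

(** Both averages are close to u x for every x in B(z, r); taking the mean over
    x turns the bound local_osc (4 r) x into mean_osc z r. *)
Lemma average_diff_osc z w (r r' : R) :
  (0 < r)%R -> (r / 2 <= r' <= r)%R -> (mdist z w < r)%R ->
  (`|trace_avg z r - trace_avg w r'| `^ p)%:E <= k_avg%:E * mean_osc z r.
Proof.
move=> r0 rr' zw.
apply: le_average_integral => //.
- exact: D0.
- by apply: measurable_funTS; exact: measurable_local_osc.
- by move=> x; exact: local_osc_ge0.
- exact: ltW k_avg_gt0.
move=> x zx.
have zz : (mdist z z < r)%R by rewrite mdistxx.
have rr : (r / 2 <= r <= r)%R by lra.
have := osc_average r0 rr zz zx; have := osc_average r0 rr' zw zx.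
set g := local_osc _ _ _ _ _.
have g0 : 0 <= g by exact: local_osc_ge0.
have [->|goo] := eqVneq g +oo.
  by move=> _ _; rewrite gt0_muley ?leey// lte_fin k_avg_gt0.
have gf : g \is a fin_num by rewrite ge0_fin_numE// lt_neqAle goo leey.
rewrite -(fineK gf) -!EFinM !lee_fin => h1 h2.
rewrite (_ : _ - _ = (trace_avg z r - u x) + (u x - trace_avg w r'))%R; last by ring.
apply: (@le_trans _ _ ((`|trace_avg z r - u x| + `|u x - trace_avg w r'|) `^ p)%R).
  by apply: le_powR => //; exact: ler_normD.
apply: le_trans (powR_add_le _ _ _) _ => //.
rewrite /k_avg -mulrA ler_pM2l// distrC.
lra.
Qed.

Lemma mean_dist_average z (r : R) : (0 < r)%R ->
  mean_dist z r (trace_avg z r) <= k_osc%:E * mean_osc z r.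
Proof.
move=> r0; rewrite /mean_dist /mean_osc muleCA.
rewrite lee_wpmul2l ?inve_ge0//.
rewrite -ge0_integralZl//; last 3 first.
- by apply: measurable_funTS; exact: measurable_local_osc.
- by move=> *; exact: local_osc_ge0.
- by rewrite lee_fin ltW// k_osc_gt0.
apply: ge0_integral_mono => x zx; first by rewrite lee_fin powR_ge0.
by apply: (osc_average r0 _ _ zx); rewrite ?mdistxx//; lra.
Qed.

Lemma mean_dist_shift z (r L M : R) : (0 < r)%R ->
  mean_dist z r M <= (2 `^ p)%:E * (mean_dist z r L + (`|L - M| `^ p)%:E).
Proof.
move=> r0; have Dz := D0 z r0.
apply: (@le_trans _ _ ((mu (D z r))^-1 * \int[mu]_(x in D z r)
   ((2 `^ p)%:E * ((`|u x - L| `^ p)%:E + (`|L - M| `^ p)%:E)))).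
  rewrite lee_wpmul2l ?inve_ge0//.
  apply: ge0_integral_mono => x _; first by rewrite lee_fin powR_ge0.
  rewrite -EFinD -EFinM lee_fin.
  apply: le_trans (powR_add_le _ _ _) => //; apply: le_powR => //.
  by rewrite (_ : u x - M = (u x - L) + (L - M))%R ?ler_normD//; ring.
rewrite ge0_integralZl//; last 2 first.
- by apply: emeasurable_funD => //; exact: measurable_udist.
- by move=> x _; rewrite -EFinD lee_fin addr_ge0 ?powR_ge0.
rewrite ge0_integralD//; last exact: measurable_udist.
rewrite muleCA lee_wpmul2l ?lee_fin ?(ltW tp0)//.
rewrite integral_cst// ge0_muleDr ?lee_fin ?powR_ge0//; last first.
  by apply: integral_ge0 => *; rewrite lee_fin powR_ge0.
rewrite leeD2l// muleCA mulVe ?mule1//; case/andP: Dz => d0 doo.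
  by rewrite gt_eqF.
by rewrite ge0_fin_numE.
Qed.

Lemma mean_dist_radius z (r s L : R) : (0 < r)%R -> (r <= s <= 2 * r)%R ->
  mean_dist z r L <= (Cmu ^+ 5)%:E * mean_dist z s L.
Proof.
move=> r0 rs; have s0 : (0 < s)%R by lra.
apply: mean_integral_le => //; rewrite ?D0//.
- by apply: preimage_ball_sub; rewrite mdistxx; lra.
- by apply: (preimage_ball_doubling iso dns dbl Cmu1); rewrite ?mdistxx//; lra.
Qed.

End local_estimates.

(** * Trace values at Lebesgue points of the boundary *)

Section trace_value.
Context (R : realType) (X Z : metricType R) (x0 : X) (iota : X -> Z).
Variables (mu : {measure set (borel x0) -> \bar R}) (Cmu p : R).
Hypotheses (iso : Defs.isometry iota) (dns : dense (range iota)).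
Hypotheses (dbl : doubling mu Cmu) (Cmu1 : 1 <= Cmu) (p1 : 1 <= p).
Local Open Scope ereal_scope.

Local Notation D a r := (iota @^-1` ball a r).
Local Notation mdis := (mean_dist iota mu p).
Local Notation avg := (trace_avg iota mu).
Local Notation osc := (mean_osc iota mu p).
Local Notation kosc := (k_osc Cmu p).
Local Notation kavg := (k_avg Cmu p).

Let p0 : (0 <= p)%R. Proof. exact: le_trans p1. Qed.
Let pn0 : p != 0%R. Proof. by rewrite gt_eqF// (lt_le_trans _ p1). Qed.
Let tp0 : (0 < 2 `^ p :> R)%R. Proof. by rewrite powR_gt0. Qed.

(** z is a Lebesgue point of u, in the sense of L ^ p means, with value L. *)
Definition lebesgue_value (u : X -> R) (z : Z) (L : R) : Prop :=
  forall e : R, (0 < e)%R -> exists2 d : R, (0 < d)%R &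
    forall r, (0 < r < d)%R -> mdis u z r L <= e%:E.

(** A limit superior is a measurable function of z whether or not the averages
    converge. *)
Definition trace_val (u : X -> R) (z : Z) : R :=
  fine (limn_esup (fun k => (avg u z (2^-1 ^+ k))%:E)).

Lemma lebesgue_value_trace u z L :
  measurable_fun [set: borel x0] (u : borel x0 -> R) ->
  lebesgue_value u z L -> trace_val u z = L.
Proof.
move=> meas_u uL.
have : (avg u z (2^-1 ^+ k))%:E @[k --> \oo] --> L%:E.
  apply: cvg_EFin; first exact: nearW.
  apply/cvgrPdist_le => /= e e0.
  have e1 : (0 < e `^ p / 2 `^ p)%R by rewrite divr_gt0 ?powR_gt0.
  have [d d0 ud] := uL _ e1.
  have : ((2^-1 ^+ k)%R : R) @[k --> \oo] --> (0%R : R).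
    by apply: cvg_expr; rewrite ger0_norm ?invr_ge0// invf_lt1// ltr1n.
  move=> /cvgrPdist_lt /(_ _ d0); apply: filterS => k.
  rewrite sub0r normrN => hk.
  have r0 : (0 < 2^-1 ^+ k :> R)%R by rewrite exprn_gt0 ?invr_gt0.
  have := ud ((2^-1 ^+ k)%R : R); rewrite r0/=.
  rewrite ger0_norm ?(ltW r0)// in hk => /(_ hk) h.
  have := @average_dist_powR _ (borel x0) R mu _ p
    (measurable_preimage_ball iso z _) (preimage_ball_gt0 iso dns dbl z r0) p1 u L
    (@measurable_u _ _ x0 u meas_u (D z (2^-1 ^+ k)%R)).
  move=> /le_trans/(_ (lee_wpmul2l _ h)).
  rewrite lee_fin (ltW tp0) => /(_ isT).
  rewrite -EFinM lee_fin mulrC divfK ?gt_eqF// => h'.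
  rewrite distrC leNgt; apply/negP => elt; move: h'; apply/negP; rewrite -ltNge.
  by apply: gt0_ltr_powR; rewrite ?nnegrE ?(lt_le_trans _ p1) ?(ltW e0).
move=> h; rewrite /trace_val.
by have [_ ->] := cvg_limn_einf_sup h.
Qed.

Lemma lebesgue_valueD u v (a b : R) z L L' :
  measurable_fun [set: borel x0] (u : borel x0 -> R) ->
  measurable_fun [set: borel x0] (v : borel x0 -> R) ->
  lebesgue_value u z L -> lebesgue_value v z L' ->
  lebesgue_value (fun x => a * u x + b * v x)%R z (a * L + b * L')%R.
Proof.
move=> meas_u mv uL vL e e0.
pose ka : R := (2 `^ p * (`|a| `^ p + 1))%R.
pose kb : R := (2 `^ p * (`|b| `^ p + 1))%R.
have ka0 : (0 < ka)%R by rewrite mulr_gt0// ltr_wpDl ?powR_ge0.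
have kb0 : (0 < kb)%R by rewrite mulr_gt0// ltr_wpDl ?powR_ge0.
have [d d0 ud] := uL (e / 2 / ka)%R (divr_gt0 (divr_gt0 e0 (ltr0Sn R 1)) ka0).
have [d' d'0 vd] := vL (e / 2 / kb)%R (divr_gt0 (divr_gt0 e0 (ltr0Sn R 1)) kb0).
exists (Num.min d d'); first by rewrite lt_min d0.
move=> r /andP[r0]; rewrite lt_min => /andP[rd rd'].
have := ud r; rewrite r0 => /(_ rd) h1; have := vd r; rewrite r0 => /(_ rd') h2.
apply: (@le_trans _ _ (ka%:E * mdis u z r L + kb%:E * mdis v z r L')); last first.
  apply: (@le_trans _ _ (ka%:E * (e / 2 / ka)%:E + kb%:E * (e / 2 / kb)%:E)).
    by apply: leeD; rewrite lee_wpmul2l// lee_fin ltW.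
  rewrite -!EFinM -EFinD lee_fin [(ka * _)%R]mulrC [(kb * _)%R]mulrC !divfK ?gt_eqF//.
  lra.
have mD := measurable_preimage_ball (x0 := x0) iso z r.
rewrite /mean_dist [ka%:E * _]muleCA [kb%:E * _]muleCA.
have mU w M : measurable_fun [set: borel x0] (w : borel x0 -> R) ->
    measurable_fun (D z r : set (borel x0)) (fun x => (`|w x - M| `^ p)%:E).
  by move=> ?; exact: measurable_udist.
have pE0 (w : X -> R) M (x : X) : 0 <= (`|w x - M| `^ p)%:E by rewrite lee_fin powR_ge0.
have I0 (k : R) (w : X -> R) M : (0 < k)%R ->
    0 <= \int[mu]_(x in D z r) (k%:E * (`|w x - M| `^ p)%:E).
  by move=> k0; apply: integral_ge0 => *; rewrite mule_ge0// lee_fin ltW.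
have IZ (k : R) (w : X -> R) M : (0 < k)%R ->
    measurable_fun [set: borel x0] (w : borel x0 -> R) ->
    k%:E * \int[mu]_(x in D z r) (`|w x - M| `^ p)%:E =
    \int[mu]_(x in D z r) (k%:E * (`|w x - M| `^ p)%:E).
  move=> k0 mw; rewrite ge0_integralZl//; first exact: mU.
  by rewrite lee_fin ltW.
rewrite !IZ//.
rewrite -ge0_muleDr ?I0// -ge0_integralD//;
  do ?[by apply: measurable_funeM; exact: mU
      |by move=> *; rewrite mule_ge0// lee_fin ltW].
rewrite lee_wpmul2l ?inve_ge0//; apply: ge0_integral_mono => x _ //.
rewrite -!EFinM -EFinD lee_fin.
rewrite (_ : _ - _ = a * (u x - L) + b * (v x - L'))%R; last by ring.
apply: (@le_trans _ _ ((`|a| * `|u x - L| + `|b| * `|v x - L'|) `^ p)%R).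
  by apply: le_powR => //; rewrite -!normrM ler_normD.
apply: le_trans (powR_add_le _ _ _) _; rewrite ?mulr_ge0//.
rewrite !powRM// /ka /kb mulrDr -!mulrA; apply: lerD.
  by rewrite ler_pM2l// ler_wpM2r ?powR_ge0// lerDl.
by rewrite ler_pM2l// ler_wpM2r ?powR_ge0// lerDl.
Qed.

Lemma lebesgue_value_ae u v z L :
  measurable_fun [set: borel x0] (u : borel x0 -> R) ->
  measurable_fun [set: borel x0] (v : borel x0 -> R) ->
  {ae mu, forall x, u x = v x} ->
  lebesgue_value u z L -> lebesgue_value v z L.
Proof.
move=> meas_u mv uv uL e e0; have [d d0 h] := uL e e0.
exists d; first exact: d0.
move=> r rd.
suff E : mdis u z r L = mdis v z r L by rewrite -E; exact: h.
have mD := measurable_preimage_ball (x0 := x0) iso z r.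
congr (_ * _); apply: (ge0_ae_eq_integral mD).
- exact: measurable_udist.
- exact: measurable_udist.
- by move=> *; rewrite lee_fin powR_ge0.
- by move=> *; rewrite lee_fin powR_ge0.
by apply: filterS uv => x /= -> _.
Qed.

Variable b : R.
Hypothesis b1 : (1 < b)%R.

Definition decay : R := (b^-1 `^ p^-1)%R.
Definition k_q : R := (kavg * (1 - decay)^-1 `^ p)%R.

Lemma decay01 : (0 < decay < 1)%R.
Proof.
have b0 : (0 < b)%R by rewrite (lt_trans _ b1).
apply/andP; split; first by rewrite powR_gt0// invr_gt0.
rewrite (_ : 1 = 1 `^ p^-1)%R; last by rewrite powR1.
apply: gt0_ltr_powR; rewrite ?nnegrE ?invr_ge0 ?invr_gt0//.
- exact: lt_le_trans p1.
- exact: ltW.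
- by rewrite invf_lt1.
Qed.

Lemma k_q_gt0 : (0 < k_q)%R.
Proof.
have /andP[_ l1] := decay01.
by rewrite mulr_gt0 ?k_avg_gt0// powR_gt0// invr_gt0; lra.
Qed.

Variable u : X -> R.
Hypothesis meas_u : measurable_fun [set: borel x0] (u : borel x0 -> R).

(** As b > 1, finiteness of this sum forces the oscillation to decay
    geometrically along the scales t / 2 ^ k. *)
Definition weighted_osc (z : Z) (t : R) : \bar R :=
  \sum_(k <oo) (b ^+ k)%:E * osc u z (t / 2 ^+ k).

Let wosc_ge0 z t k : 0 <= (b ^+ k)%:E * osc u z (t / 2 ^+ k).
Proof.
by rewrite mule_ge0 ?mean_osc_ge0// lee_fin exprn_ge0// ltW// (lt_trans _ b1).
Qed.

Lemma weighted_osc_ge0 z t : 0 <= weighted_osc z t.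
Proof. by apply: nneseries_ge0 => k _ _; exact: wosc_ge0. Qed.

Lemma mean_osc_le_weighted z t : osc u z t <= weighted_osc z t.
Proof.
apply: le_trans (nneseries_term_le 0 (wosc_ge0 z t)).
by rewrite !expr0 mul1e divr1.
Qed.

(** If the sum is finite, mean_osc at scale t / 2 ^ k is O(b ^ - k), so the
    averages at these scales converge geometrically, to L say, and the p-means of
    |u - L| tend to 0 along them. A radius between two consecutive scales costs
    one doubling constant. *)
Lemma weighted_osc_lebesgue z t : (0 < t)%R -> weighted_osc z t < +oo ->
  exists2 L, lebesgue_value u z L &
    (`|L - avg u z t| `^ p)%:E <= k_q%:E * weighted_osc z t.
Proof.
move=> t0 Woo; set W := weighted_osc z t in Woo *.
have Cmu0 : (0 <= Cmu)%R by exact: le_trans Cmu1.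
have b0 : (0 < b)%R by rewrite (lt_trans _ b1).
have bk0 k : (0 < b ^+ k)%R by rewrite exprn_gt0.
have W0 : 0 <= W by exact: weighted_osc_ge0.
have Wf : W \is a fin_num by rewrite ge0_fin_numE.
pose q := fine W; have q0 : (0 <= q)%R by rewrite fine_ge0.
have WE : W = q%:E by rewrite fineK.
have tk0 k : (0 < t / 2 ^+ k)%R by rewrite divr_gt0 ?exprn_gt0.
have oscb k : osc u z (t / 2 ^+ k) <= (q / b ^+ k)%:E.
  have : (b ^+ k)%:E * osc u z (t / 2 ^+ k) <= q%:E.
    by rewrite -WE; exact: nneseries_term_le.
  by rewrite -lee_pdivlMl// -EFinM (mulrC _ q).
pose M := ((kavg * q) `^ p^-1)%R.
have M0 : (0 <= M)%R by exact: powR_ge0.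
have kavg0 : (0 < kavg)%R by exact: k_avg_gt0.
have /andP[l0 l1] := decay01.
have lp k : ((decay ^+ k) `^ p = (b ^+ k)^-1)%R.
  rewrite -powR_mulrn ?ltW// powRAC /decay powR_inv_id ?powR_mulrn ?invr_ge0 ?ltW//.
  by rewrite exprVn.
have hstep k : (`|avg u z (t / 2 ^+ k) - avg u z (t / 2 ^+ k.+1)| <= M * decay ^+ k)%R.
  have zz : (mdist z z < t / 2 ^+ k)%R by rewrite mdistxx.
  have rr : (t / 2 ^+ k / 2 <= t / 2 ^+ k.+1 <= t / 2 ^+ k)%R.
    have -> : (t / 2 ^+ k.+1 = t / 2 ^+ k / 2)%R by rewrite exprSr invfM mulrA.
    by have := tk0 k; lra.
  have := average_diff_osc iso dns dbl Cmu1 p1 meas_u (tk0 k) rr zz.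
  move=> /le_trans/(_ (lee_wpmul2l _ (oscb k))).
  rewrite lee_fin (ltW kavg0) => /(_ isT); rewrite -EFinM lee_fin => h.
  rewrite -(@powR_id_inv _ `|_| p)// /M.
  apply: (@le_trans _ _ ((kavg * (q / b ^+ k)) `^ p^-1)%R).
    by apply: le_powR; rewrite ?invr_ge0// powR_ge0.
  rewrite mulrA powRM ?mulr_ge0 ?invr_ge0 ?(ltW kavg0) ?(ltW (bk0 k))//.
  by rewrite -lp powR_id_inv// exprn_ge0// ltW.
have [L hL] := geometric_steps_limit M0 decay01 hstep.
have hLp k : (`|avg u z (t / 2 ^+ k) - L| `^ p <= k_q * q / b ^+ k)%R.
  apply: (@le_trans _ _ ((M / (1 - decay) * decay ^+ k) `^ p)%R).
    exact: le_powR.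
  have d0 : (0 <= (1 - decay)^-1)%R by rewrite invr_ge0; lra.
  rewrite !powRM ?mulr_ge0 ?exprn_ge0 ?(ltW l0)// lp /M powR_inv_id ?mulr_ge0 ?(ltW kavg0)//.
  by rewrite /k_q [(_ * q * _)%R]mulrAC.
exists L; last first.
  by rewrite distrC WE -EFinM lee_fin; have := hLp 0%N; rewrite !expr0 !divr1.
pose C := (Cmu ^+ 5 * (2 `^ p * ((kosc + k_q) * q)))%R.
have kosc0 : (0 < kosc)%R by exact: k_osc_gt0.
have C0 : (0 <= C)%R.
  rewrite /C !mulr_ge0 ?exprn_ge0 ?powR_ge0 ?(le_trans _ Cmu1)//.
  by rewrite addr_ge0 ?ltW ?k_q_gt0.
have main n r : (0 < r <= t / 2 ^+ n)%R -> mdis u z r L <= (C / b ^+ n)%:E.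
  move=> /[dup] /andP[r0 _] /dyadic_scale[j].
  have E m : (t / 2 ^+ n / 2 ^+ m = t / 2 ^+ (n + m))%R.
    by rewrite exprD invfM mulrA.
  rewrite !E => /andP[rj1 rj].
  have rs : (r <= t / 2 ^+ (n + j) <= 2 * r)%R.
    rewrite rj/= ltW//; move: rj1; rewrite addnS exprS invfM mulrCA.
    by rewrite -ltr_pdivlMl ?invr_gt0// invrK.
  apply: le_trans (mean_dist_radius p iso dns dbl Cmu1 u z L r0 rs) _.
  apply: (@le_trans _ _ (C / b ^+ (n + j))%:E); last first.
    rewrite lee_fin ler_wpM2l// lef_pV2 ?posrE// ler_weXn2l ?leq_addr//.
    exact: ltW.
  rewrite (_ : C / b ^+ (n + j) =
    Cmu ^+ 5 * (2 `^ p * ((kosc + k_q) * (q / b ^+ (n + j)))))%R; last first.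
    by rewrite /C; ring.
  rewrite (EFinM (Cmu ^+ 5)%R) lee_wpmul2l ?lee_fin ?exprn_ge0//.
  apply: le_trans (mean_dist_shift iso dns dbl p1 meas_u z (avg u z (t / 2 ^+ (n + j))) L (tk0 (n + j)%N)) _.
  rewrite (EFinM (2 `^ p)%R) lee_wpmul2l ?lee_fin ?(ltW tp0)//.
  rewrite mulrDl EFinD; apply: leeD; last by rewrite lee_fin (mulrA k_q).
  apply: le_trans (mean_dist_average iso dns dbl Cmu1 p1 meas_u z (tk0 (n + j)%N)) _.
  by rewrite (EFinM kosc) lee_wpmul2l ?lee_fin ?(ltW kosc0).
move=> e e0.
have : ((b^-1 ^+ k)%R : R) @[k --> \oo] --> (0%R : R).
  by apply: cvg_expr; rewrite ger0_norm ?invr_ge0 ?(ltW b0)// invf_lt1.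
have C1 : (0 < C + 1)%R by rewrite ltr_wpDl.
move=> /cvgrPdist_lt /(_ (e / (C + 1))%R (divr_gt0 e0 C1)) [n _ /(_ n (leqnn _))/=].
rewrite sub0r normrN exprVn ger0_norm ?invr_ge0 ?(ltW (bk0 n))// => hn.
exists (t / 2 ^+ n)%R => // r /andP[r0 rn].
apply: (le_trans (main n r _)); first by rewrite r0 ltW.
rewrite lee_fin; move: hn; rewrite ltr_pdivlMr// => hn.
apply: le_trans (ltW hn); rewrite mulrC ler_wpM2l ?invr_ge0 ?(ltW (bk0 n))//.
by rewrite lerDl.
Qed.

Definition k_hol : R := (2 `^ p * (k_q + 2 `^ p * (kavg + k_q)))%R.

Lemma k_hol_gt0 : (0 < k_hol)%R.
Proof.
have kq0 := k_q_gt0; have kavg0 : (0 < kavg)%R by exact: k_avg_gt0.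
by rewrite mulr_gt0// addr_gt0// mulr_gt0// addr_gt0.
Qed.

(** The bound holds for every pair of points, without an exceptional null set:
    where weighted_osc is infinite the right-hand side is +oo, and elsewhere the
    point is a Lebesgue point. *)
Lemma trace_val_hoelder z w t : (0 < t)%R -> (mdist z w < t)%R ->
  (`|trace_val u z - trace_val u w| `^ p)%:E <=
  k_hol%:E * (weighted_osc z t + weighted_osc w t).
Proof.
move=> t0 zw.
have kavg0 : (0 < kavg)%R by exact: k_avg_gt0.
have kq0 := k_q_gt0.
have kh0 := k_hol_gt0.
have [Wz|Wz] := ltP (weighted_osc z t) +oo; last first.
  move: Wz; rewrite leye_eq => /eqP ->.
  by rewrite addye ?gt0_muley ?leey// gt_eqF// (lt_le_trans (ltNy0)) ?weighted_osc_ge0.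
have [Ww|Ww] := ltP (weighted_osc w t) +oo; last first.
  move: Ww; rewrite leye_eq => /eqP ->.
  by rewrite addey ?gt0_muley ?leey// gt_eqF// (lt_le_trans (ltNy0)) ?weighted_osc_ge0.
have [L uL hL] := weighted_osc_lebesgue t0 Wz.
have [L' uL' hL'] := weighted_osc_lebesgue t0 Ww.
rewrite (lebesgue_value_trace meas_u uL) (lebesgue_value_trace meas_u uL').
have tt : (t / 2 <= t <= t)%R by lra.
have := average_diff_osc iso dns dbl Cmu1 p1 meas_u t0 tt zw.
move=> /le_trans/(_ (lee_wpmul2l _ (mean_osc_le_weighted z t))).
rewrite lee_fin (ltW kavg0) => /(_ isT).
move: Wz Ww hL hL'.
have := weighted_osc_ge0 z t; have := weighted_osc_ge0 w t.
move: (weighted_osc z t) (weighted_osc w t) => [qz| |] [qw| |]//.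
rewrite !lee_fin => qw0 qz0 _ _ hL hL' h.
rewrite (_ : L - L' = (L - avg u z t) + ((avg u z t - avg u w t) + (avg u w t - L')))%R; last by ring.
apply: (@le_trans _ _ ((`|L - avg u z t| + (`|avg u z t - avg u w t| + `|avg u w t - L'|)) `^ p)%R).
  apply: le_powR => //; apply: le_trans (ler_normD _ _) _.
  by rewrite lerD2l ler_normD.
apply: le_trans (powR_add_le p0 _ _) _; rewrite ?addr_ge0//.
rewrite /k_hol -mulrA ler_pM2l//.
have := powR_add_le p0 (normr_ge0 (avg u z t - avg u w t)%R) (normr_ge0 (avg u w t - L')%R).
rewrite (distrC (avg u w t)) => h3.
apply: le_trans (lerD hL h3) _.
apply: (@le_trans _ _ (k_q * qz + 2 `^ p * (kavg * qz + k_q * qw)))%R.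
  by rewrite lerD2l ler_pM2l// lerD.
have t1 := mulr_ge0 (ltW kq0) qw0.
have t2 := mulr_ge0 (ltW tp0) (mulr_ge0 (ltW kavg0) qw0).
have t3 := mulr_ge0 (ltW tp0) (mulr_ge0 (ltW kq0) qz0).
lra.
Qed.

End trace_value.

(** * The boundary measure *)

Section tonelli_kernel.
Context (R : realType) (X Y Z : metricType R) (x0 : X) (y0 : Y).
Variables (mu : {measure set (borel x0) -> \bar R})
  (nu : {measure set (borel y0) -> \bar R}).
Hypotheses (muB : finite_balls mu) (nuB : finite_balls nu).
Variables (psi : X -> Z) (phi : Y -> Z).
Hypotheses (isopsi : Defs.isometry psi) (isophi : Defs.isometry phi).
Variable a : nat -> Z.
Hypothesis adense : forall z (e : R), 0 < e -> exists n, mdist z (a n) < e.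
Local Open Scope ereal_scope.

(** After exchanging the integrals, g x is weighted by the integral of v over the
    points z at distance less than r from x. *)
Lemma tonelli_kernel (r : R) (v : borel y0 -> \bar R) (g : borel x0 -> \bar R)
    (c : \bar R) :
  measurable_fun setT v -> (forall z, 0 <= v z) ->
  measurable_fun setT g -> (forall x, 0 <= g x) ->
  (forall x, \int[nu]_(z in phi @^-1` ball (psi x) r) v z <= c) ->
  \int[nu]_z (v z * \int[mu]_(x in psi @^-1` ball (phi z) r) g x) <=
  c * \int[mu]_x g x.
Proof.
move=> mv v0 mg g0 vc.
have c0 : 0 <= c.
  by apply: le_trans (vc x0); apply: integral_ge0 => z _; exact: v0.
pose f (q : borel y0 * borel x0) :=
  if (mdist (phi q.1) (psi q.2) < r)%R then v q.1 * g q.2 else 0.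
have f0 q : 0 <= f q by rewrite /f; case: ifP => // _; rewrite mule_ge0.
have mf : measurable_fun setT f.
  apply: measurable_fun_ifT => //.
    apply: measurable_fun_ltr => //; apply: (measurable_mdist adense) => e;
      exact: measurable_isometry_mdist.
  apply: emeasurable_funM.
    exact: (measurableT_comp mv measurable_fst).
  exact: (measurableT_comp mg measurable_snd).
have mB (z : Y) : measurable (psi @^-1` ball (phi z) r : set (borel x0)).
  exact: measurable_isometry_preimage_ball.
have mB' (x : X) : measurable (phi @^-1` ball (psi x) r : set (borel y0)).
  exact: measurable_isometry_preimage_ball.
rewrite (_ : \int[nu]_z _ = \int[nu]_z \int[mu]_x f (z, x)); last first.
  apply: eq_integral => z _; rewrite -ge0_integralZl//; last exact: measurable_funTS.
  rewrite integral_mkcond; apply: eq_integral => x _.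
  rewrite /patch /f/=; case: ifPn => [|].
    by rewrite inE/= ball_mdist => ->.
  by rewrite notin_setE/= ball_mdist => /negP/negbTE ->.
rewrite (tonelli_swap muB nuB mf f0) -ge0_integralZl//.
apply: ge0_integral_mono => x _; first by apply: integral_ge0.
rewrite muleC; apply: le_trans (lee_wpmul2l (g0 x) (vc x)).
rewrite -ge0_integralZl//; last exact: measurable_funTS.
rewrite integral_mkcond.
apply: ge0_integral_mono => z _ //.
rewrite /patch /f/=; case: ifPn => [h|_].
  rewrite ifT; first by rewrite muleC.
  by rewrite inE/= ball_mdist metric_sym.
by case: ifPn => // _; rewrite mule_ge0.
Qed.

End tonelli_kernel.

Section boundary_measure.
Context (R : realType) (X Z : metricType R) (x0 : X) (iota : X -> Z).
Variables (z0 : boundary iota).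
Variables (mu : {measure set (borel x0) -> \bar R})
  (nu : {measure set (borel z0) -> \bar R}) (Cmu theta Ct : R).
Hypotheses (iso : Defs.isometry iota) (dns : dense (range iota)).
Hypotheses (dbl : doubling mu Cmu) (Cmu1 : 1 <= Cmu).
Hypotheses (diam0 : (0 < diam (~` range iota))%E).
Hypotheses (theta0 : 0 < theta) (Ct1 : 1 <= Ct).
Hypothesis reg : codim_regular mu nu theta Ct.

Local Open Scope ereal_scope.
Local Notation D a r := (iota @^-1` ball a r).
Local Notation Dm := (diam (~` range iota)).

Lemma bdpt_isometry : Defs.isometry (@bdpt R X Z iota).
Proof. by []. Qed.

Lemma mdist_le_diam (z w : boundary iota) : (mdist z w)%:E <= Dm.
Proof.
apply: ereal_sup_ubound; exists (bdpt z); first exact: (set_valP z).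
by exists (bdpt w) => //; exact: (set_valP w).
Qed.

Lemma ball_gt_diam (z : boundary iota) (r : R) : Dm < r%:E -> ball z r = setT.
Proof.
move=> Dr; apply/seteqP; split => // w _; rewrite ball_mdist -lte_fin.
exact: le_lt_trans (mdist_le_diam z w) Dr.
Qed.

(** Codimension regularity concerns radii up to twice the diameter. If t is
    larger, the least i with t / 2 ^ i <= 2 diam gives t / 2 ^ i > diam, and the
    balls of radius t and t / 2 ^ i are both the whole boundary. *)
Lemma dyadic_below_diam (t : R) : (0 < t)%R ->
  exists i, ((t / 2 ^+ i)%:E <= 2%:E * Dm) /\
    forall z : boundary iota, ball z t = ball z (t / 2 ^+ i).
Proof.
move=> t0; have [tD|Dt] := leP t%:E (2%:E * Dm).
  by exists 0%N; rewrite expr0 divr1.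
have Df : Dm \is a fin_num.
  rewrite ge0_fin_numE ?(ltW diam0)//; case: (Dm) Dt diam0 => //= [d _ _|].
    by rewrite ltry.
  by rewrite gt0_muley ?lte_fin.
pose d := fine Dm; have DE : Dm = d%:E by rewrite fineK.
have d0 : (0 < d)%R by rewrite -lte_fin -DE.
rewrite DE -EFinM lte_fin in Dt.
have ex : exists n, (t / 2 ^+ n <= 2 * d)%R.
  exists (Num.truncn (t / (2 * d))).+1.
  rewrite ler_pdivrMr ?exprn_gt0// mulrC -ler_pdivrMr ?mulr_gt0//.
  apply: (le_trans (ltW (truncnS_gt _))).
  by rewrite -natrX ler_nat ltnW// ltn_expl.
case: (ex_minnP ex) => -[|i] ti imin; first by rewrite expr0 divr1 leNgt Dt in ti.
exists i.+1; split; first by rewrite DE -EFinM lee_fin.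
have di : (2 * d < t / 2 ^+ i)%R.
  by rewrite ltNge; apply/negP => /imin; rewrite ltnn.
have di1 : (d < t / 2 ^+ i.+1)%R.
  by rewrite exprSr invfM mulrA ltr_pdivlMr// mulrC.
by move=> z; rewrite !ball_gt_diam// DE lte_fin//; lra.
Qed.

Let K0 : (0 < Cmu ^+ 5)%R. Proof. by rewrite exprn_gt0// (lt_le_trans _ Cmu1). Qed.
Let Ct0 : (0 < Ct)%R. Proof. exact: lt_le_trans Ct1. Qed.
Let mD a r : measurable (D a r : set (borel x0)) :=
  measurable_preimage_ball iso a r.
Let D0 a r (r0 : (0 < r)%R) : 0 < mu (D a r) < +oo :=
  preimage_ball_gt0 iso dns dbl a r0.
Let Dfin a r (r0 : (0 < r)%R) : mu (D a r) \is a fin_num.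
Proof. by have /andP[h1 h2] := D0 a r0; rewrite ge0_fin_numE// ltW. Qed.

Lemma boundary_finite_balls : finite_balls nu.
Proof.
move=> z r r0.
have [i [iD ->]] := dyadic_below_diam r0.
have ri0 : (0 < r / 2 ^+ i)%R by rewrite divr_gt0// exprn_gt0.
have [lo up] := reg z ri0 iD.
have rt0 : (0 < (r / 2 ^+ i) `^ theta)%R by rewrite powR_gt0.
have /andP[m0 moo] := D0 (bdpt z) ri0.
apply/andP; split.
  apply: lt_le_trans lo; rewrite mule_gt0 ?lte_fin ?invr_gt0//.
  by rewrite mule_gt0 ?lte_fin ?invr_gt0.
apply: (le_lt_trans up).
by rewrite /bdball -(fineK (Dfin (bdpt z) ri0)) -!EFinM ltry.
Qed.

(** If 2 r exceeds twice the diameter, then the ball of radius r already is the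
    whole boundary. *)
Lemma boundary_double_le (z : boundary iota) (r : R) : (0 < r)%R ->
  r%:E <= 2%:E * Dm ->
  nu (ball z (2 * r)%R) <= Ct%:E * (mu (D (bdpt z) (2 * r)%R) * ((r `^ theta)^-1)%:E).
Proof.
move=> r0 rD; have r20 : (0 < 2 * r)%R by lra.
have [rD2|Dr] := leP (2 * r)%:E (2%:E * Dm).
  have [_ up] := reg z r20 rD2; apply: le_trans up _.
  rewrite lee_wpmul2l ?lee_fin ?(ltW Ct0)// lee_wpmul2l// lee_fin.
  rewrite lef_pV2 ?posrE ?powR_gt0//.
  by apply: le_powR; [exact: ltW | exact: ltW | lra].
have Dr' : Dm < r%:E.
  rewrite -(@lte_pmul2l _ 2%:E) ?lte_fin//.
rewrite (ball_gt_diam z (r := 2 * r)%R); last first.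
  by apply: lt_trans Dr' _; rewrite lte_fin; lra.
rewrite -(ball_gt_diam z Dr').
have [_ up] := reg z r0 rD; apply: le_trans up _.
rewrite lee_wpmul2l ?lee_fin ?(ltW Ct0)// lee_wpmul2r ?lee_fin ?invr_ge0 ?powR_ge0//.
apply: le_measure; rewrite ?inE; [exact: mD|exact: mD|].
by apply: preimage_ball_sub; rewrite mdistxx; lra.
Qed.

Lemma boundary_ball_compare (z w : boundary iota) (r : R) : (0 < r)%R ->
  r%:E <= 2%:E * Dm -> (mdist z w < r)%R ->
  nu (ball w r) <= (Ct * (Cmu ^+ 5 * Ct))%:E * nu (ball z r).
Proof.
move=> r0 rD zw; have r20 : (0 < 2 * r)%R by lra.
apply: (@le_trans _ _ (nu (ball z (2 * r)%R))).
  apply: le_measure; rewrite ?inE; [exact: measurable_metric_ball..|].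
  by apply: subset_mball; lra.
apply: le_trans (boundary_double_le z r0 rD) _.
rewrite EFinM -muleA lee_wpmul2l ?lee_fin ?(ltW Ct0)//.
have [lo _] := reg z r0 rD.
have lo' : mu (D (bdpt z) r) * ((r `^ theta)^-1)%:E <= Ct%:E * nu (ball z r).
  by rewrite -lee_pdivrMl.
rewrite (EFinM (Cmu ^+ 5)%R) -muleA.
apply: le_trans (lee_wpmul2l _ lo'); last by rewrite lee_fin ltW.
rewrite muleA lee_wpmul2r ?lee_fin ?invr_ge0 ?powR_ge0//.
by apply: (preimage_ball_doubling iso dns dbl Cmu1); rewrite ?mdistxx; lra.
Qed.

(** The points z under the integral all lie in a ball B(z', 2 r) centred at one
    of them, and there mu(B(z, r)) is comparable with mu(B(z', 2 r)), while
    nu(B(z', 2 r)) is at most a multiple of r ^ - theta mu(B(z', 2 r)). *)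
Lemma boundary_kernel_mu (x : Z) (r : R) : (0 < r)%R -> r%:E <= 2%:E * Dm ->
  \int[nu]_(z in @bdpt R X Z iota @^-1` ball x r) (mu (D (bdpt z) r))^-1 <=
  (Cmu ^+ 5 * Ct * (r `^ theta)^-1)%:E.
Proof.
move=> r0 rD; set S := _ @^-1` _; have r20 : (0 < 2 * r)%R by lra.
have mS : measurable (S : set (borel z0)).
  exact: (measurable_isometry_preimage_ball bdpt_isometry).
have rt0 : (0 < r `^ theta)%R by rewrite powR_gt0.
have [S0|/set0P[z' Sz']] := eqVneq S set0.
  rewrite S0 integral_set0 lee_fin; apply: mulr_ge0; last by rewrite invr_ge0 ltW.
  by apply: mulr_ge0; exact: ltW.
rewrite /S/= ball_mdist in Sz'.
have Ssub : S `<=` ball z' (2 * r)%R.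
  move=> z; rewrite /S/= !ball_mdist => xz.
  have := metric_triangle (bdpt z') x (bdpt z); rewrite (metric_sym _ x).
  rewrite -[mdist (bdpt z') _]/(mdist z' z); lra.
apply: (@le_trans _ _ (\int[nu]_(z in S) ((Cmu ^+ 5)%:E * (mu (D (bdpt z') (2 * r)%R))^-1))).
  apply: ge0_integral_mono => z Sz; first by rewrite inve_ge0.
  rewrite !inve_measureE ?D0// -EFinM lee_fin.
  have pz a s : (0 < s)%R -> (0 < fine (mu (D a s)))%R.
    by move=> s0; rewrite -lte_fin fineK ?Dfin//; have /andP[] := D0 a s0.
  rewrite ler_pdivlMr ?pz// mulrC ler_pdivrMr ?pz//.
  rewrite -lee_fin EFinM !fineK ?Dfin//.
  apply: (preimage_ball_doubling iso dns dbl Cmu1) => //.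
  have := Ssub z Sz; rewrite ball_mdist -[mdist z' z]/(mdist (bdpt z') (bdpt z)); lra.
rewrite integral_cst//.
apply: (@le_trans _ _ ((Cmu ^+ 5)%:E * (mu (D (bdpt z') (2 * r)%R))^-1 * nu (ball z' (2 * r)%R))).
  rewrite lee_wpmul2l//; first by rewrite mule_ge0 ?inve_ge0// lee_fin ltW.
  by apply: le_measure; rewrite ?inE//; exact: measurable_metric_ball.
apply: (@le_trans _ _ ((Cmu ^+ 5)%:E * (mu (D (bdpt z') (2 * r)%R))^-1 *
   (Ct%:E * (mu (D (bdpt z') (2 * r)%R) * ((r `^ theta)^-1)%:E)))).
  rewrite lee_wpmul2l//; first by rewrite mule_ge0 ?inve_ge0// lee_fin ltW.
  exact: boundary_double_le.
rewrite inve_measureE ?D0// -{2}(fineK (Dfin _ r20)) -!EFinM lee_fin.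
have p0 : (fine (mu (D (bdpt z') (2 * r)%R)) != 0)%R.
  by rewrite gt_eqF// -lte_fin fineK ?Dfin//; have /andP[] := D0 (bdpt z') r20.
rewrite le_eqVlt; apply/orP; left; apply/eqP; field.
by rewrite p0 gt_eqF.
Qed.

Lemma boundary_kernel_nu (w : boundary iota) (r : R) : (0 < r)%R -> r%:E <= 2%:E * Dm ->
  \int[nu]_(z in ball w r) (nu (ball z r))^-1 <= (Ct * (Cmu ^+ 5 * Ct))%:E.
Proof.
move=> r0 rD; have nuB := boundary_finite_balls.
have nf z : nu (ball z r) \is a fin_num.
  by have /andP[h1 h2] := nuB z r r0; rewrite ge0_fin_numE// ltW.
have np z : (0 < fine (nu (ball z r)))%R.
  by rewrite -lte_fin fineK//; have /andP[] := nuB z r r0.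
have C0 : (0 < Ct * (Cmu ^+ 5 * Ct))%R by apply: mulr_gt0 => //; exact: mulr_gt0.
apply: (@le_trans _ _ (\int[nu]_(z in ball w r) ((Ct * (Cmu ^+ 5 * Ct))%:E * (nu (ball w r))^-1))).
  apply: ge0_integral_mono => z wz; first by rewrite inve_ge0.
  rewrite !inve_measureE ?nuB// -EFinM lee_fin.
  rewrite ler_pdivlMr// mulrC ler_pdivrMr//.
  rewrite -lee_fin EFinM !fineK//; apply: boundary_ball_compare => //.
  by rewrite metric_sym; rewrite ball_mdist in wz.
rewrite integral_cst; last exact: measurable_metric_ball.
rewrite inve_measureE ?nuB// -{2}(fineK (nf w)) -!EFinM lee_fin.
by rewrite divfK// gt_eqF.
Qed.

End boundary_measure.

(** * Energy of the trace at one scale *)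

Section pointwise_energy.
Context (R : realType) (X : metricType R) (x0 : X).
Variables (mu : {measure set (borel x0) -> \bar R}).
Hypothesis muB : finite_balls mu.
Variables (p t k c : R) (f : X -> R) (W : borel x0 -> \bar R).
Local Open Scope ereal_scope.
Hypotheses (t0 : (0 < t)%R) (mW : measurable_fun setT W) (W0 : forall x, 0 <= W x).
Hypotheses (k0 : (0 <= k)%R) (c0 : (0 <= c)%R).
Hypothesis fW : forall x y : X, (mdist x y < t)%R ->
  (`|f x - f y| `^ p)%:E <= k%:E * (W x + W y).
Hypothesis kerc : forall y : X,
  \int[mu]_(x in ball y t) (mu (ball (x : X) t))^-1 <= c%:E.

(** The term W x integrates to the integral of W; the term W y, by Tonelli's
    theorem, to at most c times it. *)
Lemma besov_energy_pointwise :
  besov_energy mu p t f <= (k * (1 + c))%:E * \int[mu]_x W x.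
Proof.
have mB (z : X) : measurable (ball z t : set (borel x0)).
  exact: measurable_metric_ball.
apply: (@le_trans _ _ (\int[mu]_z (k%:E *
    (W z + (mu (ball (z : X) t))^-1 * \int[mu]_(w in ball (z : X) t) W w)))).
  apply: ge0_integral_mono => z _.
    by rewrite mule_ge0 ?inve_ge0// integral_ge0// => w _; rewrite lee_fin powR_ge0.
  apply: (@le_trans _ _ ((mu (ball (z : X) t))^-1 * \int[mu]_(w in ball (z : X) t)
     (k%:E * (W z + W w)))).
    rewrite lee_wpmul2l ?inve_ge0//; apply: ge0_integral_mono => w zw.
      by rewrite lee_fin powR_ge0.
    by rewrite distrC; apply: fW; rewrite ball_mdist in zw.
  rewrite ge0_integralZl//; last 2 first.
  - by apply: emeasurable_funD => //; exact: measurable_funTS.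
  - by move=> w _; rewrite adde_ge0.
  rewrite muleCA lee_wpmul2l ?lee_fin//.
  rewrite ge0_integralD//; last exact: measurable_funTS.
  rewrite integral_cst// ge0_muleDr ?integral_ge0//; last by rewrite mule_ge0.
  have /andP[n0 noo] := muB z t0.
  rewrite leeD2r// muleCA mulVe ?mule1// ?gt_eqF//.
  by rewrite ge0_fin_numE// ltW.
have [a adense] := finite_balls_separable muB.
have idi : Defs.isometry (@id X) by [].
have mI : measurable_fun [set: borel x0] (fun z => (mu (ball (z : X) t))^-1).
  apply: (measurable_kernel_inve muB adense (fun c => measurable_mdist_cst c) idi (rho := cst t)) => //.
  by move=> z _; exact: muB.
have mJ : measurable_fun [set: borel x0] (fun z => \int[mu]_(w in ball (z : X) t) W w).
  apply: (measurable_kernel_integral muB adense (fun c => measurable_mdist_cst c) idi (measurable_cst t)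
    (h := fun q : borel x0 * borel x0 => W q.2)) => //.
  exact: (measurableT_comp mW measurable_snd).
have J0 (z : X) : 0 <= (mu (ball z t))^-1 * \int[mu]_(w in ball z t) W w.
  by rewrite mule_ge0 ?inve_ge0// integral_ge0.
rewrite ge0_integralZl//; last 2 first.
- by apply: emeasurable_funD => //; exact: emeasurable_funM.
- by move=> z _; rewrite adde_ge0.
rewrite (EFinM k) -muleA lee_wpmul2l ?lee_fin//.
rewrite ge0_integralD//; last exact: emeasurable_funM.
rewrite EFinD ge0_muleDl ?lee_fin// mul1e leeD2l//.
apply: (tonelli_kernel muB muB idi idi adense
  (v := fun z => (mu (ball (z : X) t))^-1) (g := W)) => //.
by move=> z; rewrite inve_ge0.
Qed.

End pointwise_energy.

Section trace_energy.
Context (R : realType) (X Z : metricType R) (x0 : X) (iota : X -> Z).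
Variables (z0 : boundary iota).
Variables (mu : {measure set (borel x0) -> \bar R})
  (nu : {measure set (borel z0) -> \bar R}) (Cmu theta Ct alpha p : R).
Hypotheses (iso : Defs.isometry iota) (dns : dense (range iota)).
Hypotheses (dbl : doubling mu Cmu) (Cmu1 : 1 <= Cmu) (p1 : 1 <= p).
Hypotheses (diam0 : (0 < diam (~` range iota))%E).
Hypotheses (theta0 : 0 < theta) (Ct1 : 1 <= Ct).
Hypothesis reg : codim_regular mu nu theta Ct.
Variable u : X -> R.
Hypothesis meas_u : measurable_fun [set: borel x0] (u : borel x0 -> R).

Local Open Scope ereal_scope.
Local Notation D a r := (iota @^-1` ball a r).
Local Notation Dm := (diam (~` range iota)).
Local Notation bd := (@bdpt R X Z iota).

Let muB : finite_balls mu := doubling_finite_balls dbl.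
Let nuB : finite_balls nu :=
  boundary_finite_balls iso dns dbl diam0 Ct1 reg.
Let D0 a r (r0 : (0 < r)%R) : 0 < mu (D a r) < +oo :=
  preimage_ball_gt0 iso dns dbl a r0.
Let Dfin a r (r0 : (0 < r)%R) : mu (D a r) \is a fin_num.
Proof. by have /andP[h1 h2] := D0 a r0; rewrite ge0_fin_numE// ltW. Qed.
Let K0 : (0 < Cmu ^+ 5)%R. Proof. by rewrite exprn_gt0// (lt_le_trans _ Cmu1). Qed.
Let Ct0 : (0 < Ct)%R. Proof. exact: lt_le_trans Ct1. Qed.
Let bdi : Defs.isometry bd. Proof. by []. Qed.

Let mbd c : measurable_fun setT (fun z : borel z0 => mdist (bd z) c).
Proof. exact: (measurable_isometry_mdist bdi). Qed.

Definition bd_trace : boundary iota -> R := fun z => trace_val iota mu u (bd z).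

Lemma measurable_boundary_inve (r : R) : (0 < r)%R ->
  measurable_fun [set: borel z0] (fun z => (mu (D (bd z) r))^-1).
Proof.
move=> r0; have [a adense] := completion_separable iso dns dbl.
apply: (measurable_kernel_inve muB adense mbd iso (rho := cst r)) => //.
by move=> z _; exact: D0.
Qed.

Lemma measurable_boundary_integral (r : R) (h : borel x0 -> \bar R) :
  measurable_fun setT h -> (forall x, 0 <= h x) ->
  measurable_fun [set: borel z0] (fun z => \int[mu]_(x in D (bd z) r) h x).
Proof.
move=> mh h0; have [a adense] := completion_separable iso dns dbl.
apply: (measurable_kernel_integral muB adense mbd iso (measurable_cst r)
  (h := fun q : borel z0 * borel x0 => h q.2)) => //.
exact: (measurableT_comp mh measurable_snd).
Qed.

Lemma measurable_bd_trace : measurable_fun [set: borel z0] (bd_trace : borel z0 -> R).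
Proof.
apply: (@measurableT_comp _ _ _ _ _ _ (@fine R)) => //.
apply: measurable_fun_limn_esup => k; apply/measurable_EFinP.
have r0 : (0 < 2^-1 ^+ k :> R)%R by rewrite exprn_gt0// invr_gt0.
rewrite (_ : (fun _ => _) = (fun z : borel z0 =>
   fine (\int[mu]_(x in D (bd z) (2^-1 ^+ k)%R) (u x)%:E) *
   fine ((mu (D (bd z) (2^-1 ^+ k)%R))^-1))%R); last first.
  by apply/funext => z; rewrite /trace_avg /average inve_measureE ?D0.
apply: measurable_funM; last first.
  apply: (@measurableT_comp _ _ _ _ _ _ (@fine R)) => //.
  exact: measurable_boundary_inve.
apply: (@measurableT_comp _ _ _ _ _ _ (@fine R)) => //.
under eq_fun do rewrite integralE.
have mE : measurable_fun [set: borel x0] (EFin \o (u : borel x0 -> R)).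
  exact/measurable_EFinP.
apply: emeasurable_funB; apply: measurable_boundary_integral => //.
  exact: measurable_funepos.
exact: measurable_funeneg.
Qed.

Lemma measurable_mean_osc (r : R) : (0 < r)%R ->
  measurable_fun [set: borel z0] (fun z => mean_osc iota mu p u (bd z) r).
Proof.
move=> r0; apply: emeasurable_funM; first exact: measurable_boundary_inve.
apply: measurable_boundary_integral; first exact: measurable_local_osc.
by move=> x; exact: local_osc_ge0.
Qed.

(** By Tonelli's theorem a point x of X contributes with the weight computed in
    boundary_kernel_mu, of order r ^ - theta. This power is what the trace loses:
    theta / p orders of smoothness. *)
Lemma integral_mean_osc (r : R) : (0 < r)%R -> r%:E <= 2%:E * Dm ->
  \int[nu]_z mean_osc iota mu p u (bd z) r <=
  (Cmu ^+ 5 * Ct * (r `^ theta)^-1)%:E * besov_energy mu p (4 * r) u.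
Proof.
move=> r0 rD; have [a adense] := completion_separable iso dns dbl.
apply: (tonelli_kernel muB nuB iso bdi adense
  (v := fun z => (mu (D (bd z) r))^-1) (g := local_osc mu p u (4 * r)%R)).
- exact: measurable_boundary_inve.
- by move=> z; rewrite inve_ge0.
- exact: measurable_local_osc.
- by move=> x; exact: local_osc_ge0.
- move=> x.
  exact: (boundary_kernel_mu iso dns dbl Cmu1 theta0 Ct1 reg (iota x) r0 rD).
Qed.

Variable b : R.
Hypothesis b1 : (1 < b)%R.
Let b0 : (0 < b)%R. Proof. exact: lt_trans b1. Qed.

Local Notation W t := (fun z : boundary iota => weighted_osc iota mu p b u (bd z) t).

Lemma measurable_weighted_osc (t : R) : (0 < t)%R ->
  measurable_fun [set: borel z0] (W t).
Proof.
move=> t0; apply: ge0_emeasurable_sum => [k z _|k _].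
  by rewrite mule_ge0 ?mean_osc_ge0// lee_fin exprn_ge0// ltW.
by apply: measurable_funeM; apply: measurable_mean_osc; rewrite divr_gt0 ?exprn_gt0.
Qed.

Lemma integral_weighted_osc (t : R) : (0 < t)%R -> t%:E <= 2%:E * Dm ->
  \int[nu]_z W t z <= (Cmu ^+ 5 * Ct)%:E *
   \sum_(k <oo) (b ^+ k * ((t / 2 ^+ k) `^ theta)^-1)%:E *
      besov_energy mu p (4 * (t / 2 ^+ k)) u.
Proof.
move=> t0 tD; have tk0 k : (0 < t / 2 ^+ k)%R by rewrite divr_gt0 ?exprn_gt0.
have bk0 k : (0 <= b ^+ k)%R by rewrite exprn_ge0// ltW.
rewrite /weighted_osc integral_nneseries//; last 2 first.
- by move=> k; apply: measurable_funeM; exact: measurable_mean_osc.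
- by move=> k z _; rewrite mule_ge0 ?mean_osc_ge0 ?lee_fin.
rewrite -nneseriesZl; last first.
  move=> k _; rewrite mule_ge0 ?besov_energy_ge0//.
  by rewrite lee_fin mulr_ge0// invr_ge0 powR_ge0.
apply: lee_nneseries => [k _ _|k _].
  by apply: integral_ge0 => z _; rewrite mule_ge0 ?mean_osc_ge0 ?lee_fin.
rewrite ge0_integralZl//; last 3 first.
- exact: measurable_mean_osc.
- by move=> z _; exact: mean_osc_ge0.
- by rewrite lee_fin.
have tkD : (t / 2 ^+ k)%:E <= 2%:E * Dm.
  apply: le_trans tD; rewrite lee_fin ler_pdivrMr ?exprn_gt0//.
  by rewrite ler_peMr ?(ltW t0)// exprn_ege1// ler1n.
apply: le_trans (lee_wpmul2l _ (integral_mean_osc (tk0 k) tkD)) _.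
  by rewrite lee_fin.
rewrite muleA [leRHS]muleA -!EFinM lee_wpmul2r ?besov_energy_ge0// lee_fin.
by rewrite le_eqVlt; apply/orP; left; apply/eqP; ring.
Qed.

Definition k_energy : R := (k_hol Cmu p b * (1 + Ct * (Cmu ^+ 5 * Ct)))%R.

Lemma energy_bd_trace_le (t : R) : (0 < t)%R -> t%:E <= 2%:E * Dm ->
  besov_energy nu p t bd_trace <= k_energy%:E * \int[nu]_z W t z.
Proof.
move=> t0 tD.
have kc0 : (0 < Ct * (Cmu ^+ 5 * Ct))%R by apply: mulr_gt0 => //; exact: mulr_gt0.
have mW := measurable_weighted_osc t0.
have W0 (z : boundary iota) := weighted_osc_ge0 iota mu p b1 u (bd z) t.
have kh0 := ltW (k_hol_gt0 Cmu1 p1 b1).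
have Kn (w : boundary iota) :=
  boundary_kernel_nu iso dns dbl Cmu1 diam0 theta0 Ct1 reg w t0 tD.
have H (z w : boundary iota) (zw : (mdist z w < t)%R) :=
  trace_val_hoelder iso dns dbl Cmu1 p1 b1 meas_u t0 (zw : (mdist (bd z) (bd w) < t)%R).
exact: (besov_energy_pointwise nuB t0 mW W0 kh0 (ltW kc0) H Kn).
Qed.

End trace_energy.

(** * Sums over dyadic scales *)

Section scale_sum.
Context (R : realType).
Variables (E : R -> \bar R) (alpha p k : R).
Hypotheses (mE : measurable_fun setT E) (E0 : forall t, (0 <= E t)%E).
Hypotheses (p1 : 1 <= p) (k01 : 0 < k < 1).
Local Open Scope ereal_scope.

Let p0 : (0 < p)%R. Proof. exact: lt_le_trans p1. Qed.
Let k0 : (0 < k)%R. Proof. by case/andP: k01. Qed.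

Definition scaled (t : R) : \bar R := ((t `^ (alpha * p))^-1)%:E * E t.

(** Of the two factors k ^ m, one is spent in raising the series to a power and
    the other in summing the resulting integrals. *)
Definition scale_sum (t : R) : \bar R :=
  \sum_(m <oo) (k ^+ m)%:E * ((k ^+ m)%:E * scaled (4 * (t / 2 ^+ m))).

Lemma scaled_ge0 t : 0 <= scaled t.
Proof. by rewrite mule_ge0// lee_fin invr_ge0 powR_ge0. Qed.

Lemma measurable_scaled : measurable_fun setT scaled.
Proof.
apply: emeasurable_funM => //; apply/measurable_EFinP.
rewrite (_ : (fun _ => _) = (fun t : R => (t `^ (- (alpha * p)))%R)).
  exact: measurable_powR.
by apply/funext => t; rewrite powRN.
Qed.

Let term_ge0 m t : 0 <= (k ^+ m)%:E * scaled (4 * (t / 2 ^+ m)).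
Proof. by rewrite mule_ge0 ?scaled_ge0// lee_fin exprn_ge0// ltW. Qed.

Lemma scale_sum_ge0 t : 0 <= scale_sum t.
Proof.
apply: nneseries_ge0 => m _ _.
by rewrite mule_ge0 ?term_ge0// lee_fin exprn_ge0// ltW.
Qed.

Lemma scaled_powR (s t : R) : (0 < t)%R -> (0 < s)%R ->
  scaled t `^ (s / p) * (t^-1)%:E =
  E t `^ (s / p) * ((t `^ (alpha * s + 1))^-1)%:E.
Proof.
move=> t0 s0; rewrite /scaled poweRM ?lee_fin ?invr_ge0 ?powR_ge0//.
rewrite muleAC muleC; congr (_ * _); rewrite poweR_EFin -EFinM; congr (_%:E).
rewrite -powRN -powRrM powRD; last by rewrite (gt_eqF t0) implybT.
rewrite powRr1 ?(ltW t0)// invfM -powRN; congr (_ `^ _ / _)%R.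
by field; rewrite gt_eqF.
Qed.

Definition k_scale (s : R) : R := ((1 - k)^-1 `^ s / (1 - k `^ s))%R.

Lemma k_scale_gt0 s : (0 < s)%R -> (0 < k_scale s)%R.
Proof.
move=> s0; have /andP[_ k1] := k01.
have ks1 : (k `^ s < 1)%R.
  rewrite (_ : 1 = 1 `^ s)%R; last by rewrite powR1.
  by apply: gt0_ltr_powR; rewrite ?nnegrE// ltW.
by rewrite divr_gt0 ?powR_gt0 ?invr_gt0; lra.
Qed.

(** The m-th term is a dilate of scaled, so its integral against dt / t does not
    depend on m, and the weights (k ^ s) ^ m left by nneseries_powR_le are
    summable. *)
Lemma integral_scale_sum (s : R) : (0 < s)%R ->
  \int[lebesgue_measure]_(t in `]0%R, +oo[) (scale_sum t `^ s * (t^-1)%:E) <=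
  (k_scale s)%:E *
    \int[lebesgue_measure]_(t in `]0%R, +oo[) (scaled t `^ s * (t^-1)%:E).
Proof.
move=> s0; have /andP[_ k1] := k01.
have ks0 : (0 < k `^ s)%R by rewrite powR_gt0.
have ks1 : (k `^ s < 1)%R.
  rewrite (_ : 1 = 1 `^ s)%R; last by rewrite powR1.
  by apply: gt0_ltr_powR; rewrite ?nnegrE// ltW.
have ksm m : 0 <= ((k `^ s) ^+ m)%:E by rewrite lee_fin exprn_ge0// ltW.
set I := \int[lebesgue_measure]_(t in _) (scaled t `^ s * _).
have mh : measurable_fun setT (fun t => scaled t `^ s).
  exact: (measurableT_comp (@measurable_poweR R s) measurable_scaled).
have tV (t : R) : `]0%R, +oo[%classic t -> 0 <= (t^-1)%:E.
  by rewrite /= in_itv/= andbT => t0; rewrite lee_fin invr_ge0 ltW.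
have I0 : 0 <= I by apply: integral_ge0 => t /tV ht; rewrite mule_ge0 ?poweR_ge0.
have [->|Ioo] := eqVneq I +oo; first by rewrite gt0_muley ?lte_fin ?k_scale_gt0// leey.
have If : I \is a fin_num by rewrite ge0_fin_numE// lt_neqAle Ioo leey.
pose A := ((1 - k)^-1 `^ s)%R.
have A0 : (0 <= A)%R by exact: powR_ge0.
have mV : measurable_fun (`]0%R, +oo[%classic : set R) (fun t : R => (t^-1)%:E).
  apply/measurable_EFinP; apply: open_continuous_measurable_fun => // t.
  rewrite inE/= in_itv/= andbT => t0.
  by apply: inv_continuous; rewrite gt_eqF.
pose G m t := (((k `^ s) ^+ m)%:E * (scaled (4 * (t / 2 ^+ m)) `^ s * (t^-1)%:E)).
have mG m : measurable_fun (`]0%R, +oo[%classic : set R) (fun t => scaled (4 * (t / 2 ^+ m)) `^ s * (t^-1)%:E).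
  apply: emeasurable_funM => //; apply: measurable_funTS.
  apply: (measurableT_comp mh); apply: measurable_funM => //.
  exact: measurable_funM.
have G0 m t : `]0%R, +oo[%classic t -> 0 <= scaled (4 * (t / 2 ^+ m)) `^ s * (t^-1)%:E.
  by move=> /tV ht; rewrite mule_ge0 ?poweR_ge0.
have mS : measurable_fun (`]0%R, +oo[%classic : set R) (fun t => \sum_(m <oo) G m t).
  apply: (@ge0_emeasurable_sum _ _ _ _ G xpredT) => [m t Dt _|m _].
    by rewrite mule_ge0 ?G0// lee_fin exprn_ge0// ltW.
  by apply: measurable_funeM; exact: mG.
have S0 (t : R) : `]0%R, +oo[%classic t -> 0 <= \sum_(m <oo) G m t.
  move=> Dt; apply: nneseries_ge0 => m _ _.
  by rewrite mule_ge0 ?G0// lee_fin exprn_ge0// ltW.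
have GI m : \int[lebesgue_measure]_(t in `]0%R, +oo[) G m t = ((k `^ s) ^+ m)%:E * I.
  have GI' : \int[lebesgue_measure]_(t in `]0%R, +oo[)
      (scaled (4 * (t / 2 ^+ m)) `^ s * (t^-1)%:E) = I.
    have c0 : (0 < 4 / 2 ^+ m :> R)%R by rewrite divr_gt0// exprn_gt0.
    have h0 t : 0 <= scaled t `^ s by exact: poweR_ge0.
    rewrite /I -(integral_dilation c0 mh h0).
    apply: eq_integral => t _; congr (scaled _ `^ _ * _).
    by rewrite mulrA mulrAC.
  rewrite /G ge0_integralZl; [|exact: measurable_itv|exact: mG|exact: G0|].
    by rewrite GI'.
  exact: ksm.
apply: (@le_trans _ _ (\int[lebesgue_measure]_(t in `]0%R, +oo[) (A%:E * \sum_(m <oo) G m t))).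
  apply: ge0_integral_mono => t /[dup] Dt /tV ht; first by rewrite mule_ge0 ?poweR_ge0.
  have := @nneseries_powR_le R k s (fun m => (k ^+ m)%:E * scaled (4 * (t / 2 ^+ m))) k01 s0 (fun m => term_ge0 m t).
  move=> /(lee_wpmul2r ht) /le_trans; apply.
  rewrite -muleA lee_wpmul2l// muleC -nneseriesZl; last by move=> m _; exact: poweR_ge0.
  apply: lee_nneseries => m _; first by rewrite mule_ge0 ?poweR_ge0.
  rewrite poweRM ?scaled_ge0 ?lee_fin ?exprn_ge0 ?(ltW k0)// poweR_EFin.
  rewrite muleC /G muleA.
  by rewrite -powR_mulrn ?(ltW k0)// powRAC powR_mulrn// ltW.
rewrite ge0_integralZl//.
rewrite integral_nneseries//; last 2 first.
- by move=> m; apply: measurable_funeM; exact: mG.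
- by move=> m t Dt; rewrite mule_ge0 ?G0// lee_fin exprn_ge0// ltW.
rewrite /k_scale -/A (EFinM A) -muleA lee_wpmul2l//.
under eq_eseriesr do rewrite GI.
rewrite -(fineK If) muleC -EFinM.
by apply: (@nneseries_geometric_le R (k `^ s) (fun=> (fine I)%:E)); rewrite ?ks0// fineK.
Qed.

End scale_sum.

(** * Besov seminorms in terms of energies *)

Section besov_scales.
Context (R : realType).
Variables (E : R -> \bar R) (alpha beta p k : R).
Hypotheses (mE : measurable_fun setT E) (E0 : forall t, (0 <= E t)%E).
Hypotheses (p1 : 1 <= p) (k01 : 0 < k < 1).
Local Open Scope ereal_scope.
Local Notation S := (scale_sum E alpha p k).

Let p0 : (0 < p)%R. Proof. exact: lt_le_trans p1. Qed.
Let k0 : (0 < k)%R. Proof. by case/andP: k01. Qed.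

Definition scale_norm (a : R) (G : R -> \bar R) (s : R) : \bar R :=
  (\int[lebesgue_measure]_(t in `]0%R, +oo[)
     (G t `^ (s / p) * ((t `^ (a * s + 1))^-1)%:E)) `^ s^-1.

Definition scale_sup (a : R) (G : R -> \bar R) : \bar R :=
  ereal_sup [set (((t `^ a)^-1)%:E * G t `^ p^-1) | t in `]0%R, +oo[].

Lemma measurable_scale_sum : measurable_fun setT S.
Proof.
apply: (@ge0_emeasurable_sum _ _ _ _ (fun m t => _) xpredT) => [m t _ _|m _].
  have km : 0 <= (k ^+ m)%:E by rewrite lee_fin exprn_ge0// ltW.
  by apply: mule_ge0 => //; apply: mule_ge0 => //; exact: scaled_ge0.
apply: measurable_funeM; apply: measurable_funeM.
apply: (measurableT_comp (measurable_scaled alpha p mE)).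
by apply: measurable_funM => //; exact: measurable_funM.
Qed.

Lemma integral_scale_sum_energy (s : R) : (1 <= s)%R ->
  \int[lebesgue_measure]_(t in `]0%R, +oo[) (S t `^ (s / p) * (t^-1)%:E) <=
  (k_scale k (s / p))%:E * \int[lebesgue_measure]_(t in `]0%R, +oo[)
     (E t `^ (s / p) * ((t `^ (alpha * s + 1))^-1)%:E).
Proof.
move=> s1; have s0 : (0 < s)%R by exact: lt_le_trans s1.
apply: le_trans (integral_scale_sum alpha p mE E0 k01 (divr_gt0 s0 p0)) _.
rewrite lee_wpmul2l//; first by rewrite lee_fin ltW// k_scale_gt0// divr_gt0.
rewrite le_eqVlt; apply/orP; left; apply/eqP.
apply: eq_integral => t; rewrite inE/= in_itv/= andbT => t0.
exact: scaled_powR.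
Qed.

Variables (F : R -> \bar R) (c : R).
Hypotheses (F0 : forall t, 0 <= F t) (c0 : (0 < c)%R).
Hypothesis FS : forall t, (0 < t)%R -> F t <= (c * t `^ (beta * p))%:E * S t.

Definition k_norm (s : R) : R := ((c `^ (s / p) * k_scale k (s / p)) `^ s^-1)%R.

Lemma scale_norm_le (s : R) : (1 <= s)%R ->
  scale_norm beta F s <= (k_norm s)%:E * scale_norm alpha E s.
Proof.
move=> s1; have s0 : (0 < s)%R by exact: lt_le_trans s1.
have sp0 : (0 < s / p)%R by rewrite divr_gt0.
have csp0 : (0 <= c `^ (s / p))%R by exact: powR_ge0.
have S0 t : 0 <= S t by exact: scale_sum_ge0.
have mI : measurable_fun (`]0%R, +oo[%classic : set R)
    (fun t => S t `^ (s / p) * (t^-1)%:E).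
  apply: emeasurable_funM.
    apply: measurable_funTS.
    exact: (measurableT_comp (@measurable_poweR R (s / p)) measurable_scale_sum).
  apply/measurable_EFinP; apply: open_continuous_measurable_fun => // t.
  rewrite inE/= in_itv/= andbT => t0.
  by apply: inv_continuous; rewrite gt_eqF.
have I0 t : `]0%R, +oo[%classic t -> 0 <= S t `^ (s / p) * (t^-1)%:E.
  rewrite /= in_itv/= andbT => t0.
  by rewrite mule_ge0 ?poweR_ge0// lee_fin invr_ge0 ltW.
rewrite /scale_norm.
set J := \int[lebesgue_measure]_(t in _) (E t `^ _ * _).
have J0 : 0 <= J.
  by apply: integral_ge0 => t _; rewrite mule_ge0 ?poweR_ge0// lee_fin invr_ge0 powR_ge0.
apply: (@le_trans _ _ (((c `^ (s / p) * k_scale k (s / p))%:E * J) `^ s^-1)); last first.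
  have ks0 := ltW (k_scale_gt0 k01 sp0).
  by rewrite poweRM// lee_fin mulr_ge0.
apply: le_poweR; first by rewrite invr_ge0 ltW.
  by apply: integral_ge0 => t _; rewrite mule_ge0 ?poweR_ge0// lee_fin invr_ge0 powR_ge0.
rewrite (EFinM (c `^ (s / p))%R) -muleA.
apply: le_trans (lee_wpmul2l _ (integral_scale_sum_energy s1)); last by rewrite lee_fin.
rewrite -ge0_integralZl; [|exact: measurable_itv|exact: mI|exact: I0|by rewrite lee_fin].
apply: ge0_integral_mono => t; rewrite /= in_itv/= andbT => t0.
  by rewrite mule_ge0 ?poweR_ge0// lee_fin invr_ge0 powR_ge0.
apply: (@le_trans _ _ (((c * t `^ (beta * p))%:E * S t) `^ (s / p) *
    ((t `^ (beta * s + 1))^-1)%:E)).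
  rewrite lee_wpmul2r ?lee_fin ?invr_ge0 ?powR_ge0//.
  by apply: le_poweR (FS t0); rewrite ?(ltW sp0)//; exact: F0.
have ct0 : (0 <= c * t `^ (beta * p))%R by rewrite mulr_ge0 ?powR_ge0// ltW.
rewrite poweRM ?lee_fin// poweR_EFin powRM ?powR_ge0 ?(ltW c0)//.
have id : ((t `^ (beta * p)) `^ (s / p) * (t `^ (beta * s + 1))^-1 = t^-1)%R.
  rewrite -powRrM -powRN -powRD; last by rewrite (gt_eqF t0) implybT.
  rewrite -[RHS]powR_inv1 ?(ltW t0)//; congr (_ `^ _)%R.
  by field; rewrite gt_eqF.
move: (S t `^ (s / p)) => Y.
by rewrite muleAC -EFinM -mulrA id EFinM -muleA (muleC _ Y).
Qed.

Lemma scaled_le_sup (N t : R) : scale_sup alpha E <= N%:E -> (0 < t)%R ->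
  scaled E alpha p t <= (N `^ p)%:E.
Proof.
move=> EN t0.
have h : ((t `^ alpha)^-1)%:E * E t `^ p^-1 <= N%:E.
  apply: le_trans EN; apply: ereal_sup_ubound; exists t => //.
  by rewrite /= in_itv/= t0.
have h0 : 0 <= ((t `^ alpha)^-1)%:E * E t `^ p^-1.
  by rewrite mule_ge0 ?poweR_ge0// lee_fin invr_ge0 powR_ge0.
have := le_poweR (ltW p0) h0 h.
rewrite poweRM ?poweR_ge0 ?lee_fin ?invr_ge0 ?powR_ge0//.
rewrite -poweRrM mulVf ?gt_eqF// poweRe1// !poweR_EFin /scaled.
by rewrite -powRN -powRrM mulNr powRN.
Qed.

Lemma scale_sum_le_sup (N t : R) : scale_sup alpha E <= N%:E -> (0 < t)%R ->
  S t <= (N `^ p / (1 - k))%:E.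
Proof.
move=> EN t0; have /andP[_ k1] := k01.
apply: nneseries_geometric_le => // m.
  apply: mule_ge0; last exact: scaled_ge0.
  by rewrite lee_fin exprn_ge0// ltW.
have tm : (0 < 4 * (t / 2 ^+ m))%R by rewrite mulr_gt0// divr_gt0// exprn_gt0.
apply: le_trans (scaled_le_sup EN tm).
rewrite -[leRHS]mul1e lee_wpmul2r ?scaled_ge0// lee_fin.
by rewrite exprn_ile1// ltW.
Qed.

Lemma scale_sup_ge0 : 0 <= scale_sup alpha E.
Proof.
apply: (@le_trans _ _ (((1 `^ alpha)^-1)%:E * E 1 `^ p^-1)).
  by rewrite mule_ge0 ?poweR_ge0// lee_fin invr_ge0 powR_ge0.
by apply: ereal_sup_ubound; exists 1%R => //; rewrite /= in_itv/= ltr01.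
Qed.

Definition k_sup : R := ((c / (1 - k)) `^ p^-1)%R.

Lemma scale_sup_le : scale_sup beta F <= k_sup%:E * scale_sup alpha E.
Proof.
have /andP[_ k1] := k01.
have ck0 : (0 < c / (1 - k))%R by rewrite divr_gt0//; lra.
have [->|Noo] := eqVneq (scale_sup alpha E) +oo.
  by rewrite gt0_muley ?leey// lte_fin powR_gt0.
have Nf : scale_sup alpha E \is a fin_num.
  by rewrite ge0_fin_numE ?scale_sup_ge0// lt_neqAle Noo leey.
set N := scale_sup alpha E in Nf *.
pose n := fine N; have n0 : (0 <= n)%R by rewrite fine_ge0// scale_sup_ge0.
have EN : N <= n%:E by rewrite fineK.
rewrite -(fineK Nf) -/n.
apply: ge_ereal_sup => _ [t /= + <-]; rewrite in_itv/= andbT => t0.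
have tb0 : (0 < t `^ beta)%R by rewrite powR_gt0.
have cb0 : (0 <= c * t `^ (beta * p))%R by rewrite mulr_ge0 ?powR_ge0// ltW.
have FN : F t <= (c * t `^ (beta * p) * (n `^ p / (1 - k)))%:E.
  apply: le_trans (FS t0) _; rewrite [leRHS]EFinM lee_wpmul2l ?lee_fin//.
  exact: scale_sum_le_sup.
have pn : (0 <= p^-1)%R by rewrite invr_ge0 ltW.
have /(lee_wpmul2l _) := le_poweR pn (F0 t) FN.
move=> /(_ ((t `^ beta)^-1)%:E); rewrite lee_fin invr_ge0 powR_ge0 => /(_ isT).
move=> /le_trans; apply; rewrite poweR_EFin -!EFinM lee_fin.
have -> : (c * t `^ (beta * p) * (n `^ p / (1 - k)) = (c / (1 - k)) * (t `^ beta * n) `^ p)%R.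
  by rewrite powRM ?powR_ge0// -powRrM; ring.
rewrite powRM ?powR_ge0 ?(ltW ck0)// powR_id_inv ?mulr_ge0 ?(ltW tb0) ?gt_eqF//.
rewrite -/k_sup.
by rewrite mulrCA mulrA (mulrA _ (t `^ beta)%R) -(mulrA k_sup) mulVf ?mulr1 ?gt_eqF.
Qed.

(** Otherwise the sum would be infinite on all of ]0, d[, which contradicts
    integral_scale_sum_energy. *)
Lemma scale_sum_finite (s d : R) : (1 <= s)%R -> (0 < d)%R ->
  scale_norm alpha E s < +oo ->
  exists2 t, (0 < t < d)%R & S t < +oo.
Proof.
move=> s1 d0 Noo; have s0 : (0 < s)%R by exact: lt_le_trans s1.
have sp0 : (0 < s / p)%R by rewrite divr_gt0.
apply: contrapT => nex.
have Soo t : (0 < t < d)%R -> S t = +oo.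
  move=> td; apply/eqP; rewrite -leye_eq leNgt; apply/negP => h.
  by apply: nex; exists t.
have {Noo}: \int[lebesgue_measure]_(t in `]0%R, +oo[)
     (S t `^ (s / p) * (t^-1)%:E) < +oo.
  apply: le_lt_trans (integral_scale_sum_energy s1) _.
  have := lty_poweRy _ Noo; rewrite gt_eqF ?invr_gt0// => /(_ isT) h.
  by rewrite lte_mul_pinfty// lee_fin ltW// k_scale_gt0.
apply/negP; rewrite -leNgt leye_eq; apply/eqP.
apply/eqP; rewrite -leye_eq.
apply: (@le_trans _ _ (\int[lebesgue_measure]_(t in (`]0%R, d[%classic : set R)) (cst +oo) t)).
  rewrite integral_cst//= lebesgue_measure_itv/= lte_fin d0.
  by rewrite sube0 gt0_mulye// lte_fin.
rewrite [leLHS]integral_mkcond [leRHS]integral_mkcond.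
apply: ge0_integral_mono => t _; first by rewrite /patch; case: ifP => //= _; exact: leey.
rewrite /patch; case: ifPn => [|_].
  rewrite inE/= in_itv/= => td; have /andP[t0 _] := td.
  rewrite ifT; last by rewrite inE/= in_itv/= t0.
  by rewrite Soo// poweRyr ?gt_eqF// gt0_mulye// lte_fin invr_gt0.
case: ifPn => // ; rewrite inE/= in_itv/= andbT => t0.
by rewrite mule_ge0 ?poweR_ge0// lee_fin invr_ge0 ltW.
Qed.

End besov_scales.

(** * Local integrability and choice of weights *)

Section finite_energy.
Context (R : realType) (X : metricType R) (x0 : X).
Variables (mu : {measure set (borel x0) -> \bar R}) (muB : finite_balls mu).
Variables (p : R) (f : X -> R).
Hypotheses (p1 : 1 <= p).
Hypothesis mf : measurable_fun [set: borel x0] (f : borel x0 -> R).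
Local Open Scope ereal_scope.

(** Some z in B(x, t / 2) has a finite mean of |f - f z| ^ p over B(z, t), and
    this ball contains B(x, t / 2). *)
Lemma finite_energy_locally_integrable (t : R) : (0 < t)%R ->
  besov_energy mu p t f < +oo -> locally_integrable_wrt mu f.
Proof.
move=> t0 foo; split=> // x; have t20 : (0 < t / 2)%R by rewrite divr_gt0.
exists (t / 2)%R => //.
have mB (y : X) r : measurable (ball y r : set (borel x0)).
  exact: measurable_metric_ball.
have [z [xz zoo]] : exists z, (mdist x z < t / 2)%R /\ local_osc mu p f t z < +oo.
  apply: contrapT => nex.
  have Loo z : ball x (t / 2) z -> local_osc mu p f t z = +oo.
    rewrite ball_mdist => xz; apply/eqP; rewrite -leye_eq leNgt; apply/negP => h.
    by apply: nex; exists z.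
  move: foo; apply/negP; rewrite -leNgt.
  apply: (@le_trans _ _ (\int[mu]_(z in ball x (t / 2)) (cst +oo) z)).
    rewrite integral_cst// gt0_mulye//.
    by have /andP[] := muB x t20.
  rewrite besov_energyE [leLHS]integral_mkcond.
  apply: ge0_integral_mono => z _.
    by rewrite /patch; case: ifP => //= _; exact: leey.
  rewrite /patch; case: ifPn => [|_]; last exact: local_osc_ge0.
  by rewrite inE => /Loo ->.
have /andP[z0 zfin] := muB z t0.
have iz : \int[mu]_(y in ball z t) (`|f y - f z| `^ p)%:E < +oo.
  rewrite ltNge leye_eq; apply/negP => /eqP h; move: zoo.
  rewrite /local_osc h gt0_muley ?ltxx//.
  by rewrite inve_gt0 ?(gt_eqF z0) ?(lt_eqF zfin).
have zz := muB z t0.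
apply: (@integrableS _ _ _ mu (ball z t)) => //.
  by apply: subset_mball; rewrite metric_sym; lra.
apply: (@integrable_of_powR _ (borel x0) R mu (ball z t) p _ zz p1 f (f z)) => //.
exact: measurable_funTS.
Qed.

End finite_energy.

Section weights.
Context (R : realType) (gam : R).
Hypothesis gam0 : 0 < gam.

(** For gam = alpha p - theta, the m-th dyadic scale gains 2 ^ (- m gam), which
    is decay_rate ^ (4 m). Half of the exponent pays for the weights
    weight_base ^ k, the other half provides the two factors of scale_sum. *)
Definition decay_rate : R := 2 `^ (- (gam / 4)).
Definition weight_base : R := (decay_rate ^+ 2)^-1.

Lemma decay_rate01 : 0 < decay_rate < 1.
Proof.
rewrite /decay_rate powR_gt0//= powRN invf_lt1 ?powR_gt0//.
have h1 : 1 `^ (gam / 4) = 1 :> R by rewrite powR1.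
rewrite -[ltLHS]h1.
by apply: gt0_ltr_powR; rewrite ?nnegrE ?divr_gt0 ?ltr1n.
Qed.

Lemma weight_base_gt1 : 1 < weight_base.
Proof.
have /andP[k0 k1] := decay_rate01.
by rewrite /weight_base invf_gt1 ?exprn_gt0// exprn_ilt1// ltW.
Qed.

Lemma dyadic_powR (t : R) m : 0 < t ->
  (t / 2 ^+ m) `^ gam = t `^ gam * decay_rate ^+ (4 * m).
Proof.
move=> t0; rewrite powRM ?invr_ge0 ?exprn_ge0 ?(ltW t0)//; congr (_ * _).
rewrite /decay_rate -[LHS]/((2 ^- m) `^ gam) -powR_invn// -powRrM.
rewrite -powR_mulrn ?powR_ge0// -powRrM; congr (_ `^ _).
by rewrite natrM; field.
Qed.

(** With r = t / 2 ^ (i + k), r ^ - theta equals r ^ gam r ^ - alphap. *)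
Lemma weight_le (alphap theta t : R) (i k : nat) :
  alphap = gam + theta -> 0 < t ->
  weight_base ^+ k * ((t / 2 ^+ (i + k)) `^ theta)^-1 <=
  4 `^ alphap * t `^ gam * (decay_rate ^+ (i + k) * (decay_rate ^+ (i + k) *
    ((4 * (t / 2 ^+ (i + k))) `^ alphap)^-1)).
Proof.
move=> ag t0; have /andP[k0 k1] := decay_rate01.
set r := t / 2 ^+ (i + k); have r0 : 0 < r by rewrite divr_gt0 ?exprn_gt0.
have rg0 : 0 < r `^ gam by rewrite powR_gt0.
have rt0 : 0 < r `^ theta by rewrite powR_gt0.
have a0 : 0 < 4 `^ alphap :> R by rewrite powR_gt0.
have tg0 : 0 < t `^ gam by rewrite powR_gt0.
have -> : (4 * r) `^ alphap = 4 `^ alphap * (r `^ gam * r `^ theta).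
  rewrite powRM ?(ltW r0)// {2}ag powRD//; by rewrite (gt_eqF r0) implybT.
have dm0 : 0 < decay_rate ^+ (i + k) by rewrite exprn_gt0.
have rgE : r `^ gam = t `^ gam * (decay_rate ^+ (i + k)) ^+ 4.
  by rewrite dyadic_powR// mulnC exprM.
have -> : 4 `^ alphap * t `^ gam * (decay_rate ^+ (i + k) *
   (decay_rate ^+ (i + k) * (4 `^ alphap * (r `^ gam * r `^ theta))^-1)) =
   ((decay_rate ^+ (i + k)) ^+ 2)^-1 * (r `^ theta)^-1.
  by rewrite rgE; field; rewrite !gt_eqF.
rewrite ler_pM2r ?invr_gt0//.
rewrite /weight_base exprVn lef_pV2 ?posrE ?exprn_gt0//.
rewrite -!exprM; apply: ler_wiXn2l; rewrite ?(ltW k0) ?(ltW k1)//.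
by rewrite mulnC leq_mul2r leq_addl orbT.
Qed.

End weights.

(** * Bounds for the trace *)

Section trace_bound.
Context (R : realType) (X Z : metricType R) (x0 : X) (iota : X -> Z).
Variables (z0 : boundary iota).
Variables (mu : {measure set (borel x0) -> \bar R})
  (nu : {measure set (borel z0) -> \bar R}) (Cmu theta Ct alpha p : R).
Hypotheses (iso : Defs.isometry iota) (dns : dense (range iota)).
Hypotheses (dbl : doubling mu Cmu) (Cmu1 : 1 <= Cmu) (p1 : 1 <= p).
Hypotheses (diam0 : (0 < diam (~` range iota))%E).
Hypotheses (theta0 : 0 < theta) (Ct1 : 1 <= Ct).
Hypothesis reg : codim_regular mu nu theta Ct.
Variable u : X -> R.
Hypothesis meas_u : measurable_fun [set: borel x0] (u : borel x0 -> R).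
Hypothesis tr0 : 0 < alpha - theta / p.

Local Open Scope ereal_scope.
Local Notation Dm := (diam (~` range iota)).
Local Notation gam := ((alpha - theta / p) * p)%R.
Local Notation kap := (decay_rate gam).
Local Notation b := (weight_base gam).
Local Notation E := (fun t => besov_energy mu p t u).
Local Notation F := (fun t => besov_energy nu p t (bd_trace mu u)).
Local Notation S := (scale_sum E alpha p kap).
Local Notation W t := (fun z : boundary iota => weighted_osc iota mu p b u (bdpt z) t).

Let p0 : (0 < p)%R. Proof. exact: lt_le_trans p1. Qed.
Let gam0 : (0 < gam)%R. Proof. exact: mulr_gt0. Qed.
Let muB : finite_balls mu := doubling_finite_balls dbl.
Let nuB : finite_balls nu :=
  boundary_finite_balls iso dns dbl diam0 Ct1 reg.
Let E0 t : 0 <= E t. Proof. exact: besov_energy_ge0. Qed.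
Let KC0 : (0 < Cmu ^+ 5 * Ct)%R.
Proof.
by rewrite mulr_gt0 ?exprn_gt0// ?(lt_le_trans _ Cmu1)// (lt_le_trans _ Ct1).
Qed.
Let k01 := decay_rate01 gam0.
Let b1 := weight_base_gt1 gam0.

Definition k_sum : R := (Cmu ^+ 5 * Ct * 4 `^ (alpha * p))%R.
Definition k_trace : R := (k_energy Cmu Ct p b * k_sum)%R.

Lemma k_energy_gt0 : (0 < k_energy Cmu Ct p b)%R.
Proof.
rewrite /k_energy mulr_gt0 ?(k_hol_gt0 Cmu1 p1 b1)// addr_gt0//.
by rewrite mulr_gt0 ?(lt_le_trans _ Ct1).
Qed.

Lemma k_sum_gt0 : (0 < k_sum)%R.
Proof. by rewrite mulr_gt0 ?powR_gt0. Qed.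

Lemma k_trace_gt0 : (0 < k_trace)%R.
Proof. by rewrite mulr_gt0 ?k_energy_gt0 ?k_sum_gt0. Qed.

Lemma integral_weighted_osc_scale (t : R) i : (0 < t)%R ->
  (t / 2 ^+ i)%:E <= 2%:E * Dm ->
  \int[nu]_z W (t / 2 ^+ i) z <= (k_sum * t `^ gam)%:E * S t.
Proof.
move=> t0 tD; have ti0 : (0 < t / 2 ^+ i)%R by rewrite divr_gt0 ?exprn_gt0.
apply: le_trans (integral_weighted_osc p iso dns dbl Cmu1 diam0 theta0 Ct1 reg
  meas_u b1 ti0 tD) _.
rewrite /k_sum -mulrA.
rewrite (EFinM (Cmu ^+ 5 * Ct)%R (4 `^ (alpha * p) * t `^ gam)%R).
rewrite -[leRHS]muleA lee_wpmul2l ?lee_fin ?(ltW KC0)//.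
have /andP[k0 _] := k01.
pose a m := (kap ^+ m)%:E * ((kap ^+ m)%:E * scaled E alpha p (4 * (t / 2 ^+ m))).
have a0 m : 0 <= a m.
  have km : 0 <= (kap ^+ m)%:E by rewrite lee_fin exprn_ge0// ltW.
  by apply: mule_ge0 => //; apply: mule_ge0 => //; exact: scaled_ge0.
have c0 : (0 <= 4 `^ (alpha * p) * t `^ gam)%R by rewrite mulr_ge0 ?powR_ge0.
apply: (@le_trans _ _ ((4 `^ (alpha * p) * t `^ gam)%:E * \sum_(k <oo) a (k + i)%N)).
  rewrite -nneseriesZl; last by move=> m _; exact: a0.
  have b0 : (0 < b)%R by exact: lt_trans b1.
  apply: lee_nneseries => [k _ _|k _].
    rewrite mule_ge0 ?besov_energy_ge0// lee_fin.
    by rewrite mulr_ge0 ?invr_ge0 ?powR_ge0// exprn_ge0// ltW.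
  have -> : (t / 2 ^+ i / 2 ^+ k = t / 2 ^+ (i + k))%R by rewrite exprD invfM mulrA.
  have ag : (alpha * p = gam + theta)%R by field; rewrite gt_eqF.
  have := weight_le gam0 i k ag t0.
  rewrite /a /scaled (addnC k i).
  have := besov_energy_ge0 mu p u (4 * (t / 2 ^+ (i + k))).
  move: (besov_energy mu p _ u) => e e0 hw.
  rewrite -lee_fin in hw; apply: (le_trans (lee_wpmul2r e0 hw)).
  by rewrite !EFinM !muleA.
apply: lee_wpmul2l; first by rewrite lee_fin.
rewrite nneseries_addn; last exact: a0.
rewrite -[S t]/(\sum_(m <oo) a m) (nneseries_split 0 i); last by move=> m _; exact: a0.
by rewrite add0n leeDr//; apply: sume_ge0 => m _; exact: a0.
Qed.

(** For t above twice the diameter, the energy at t is the energy at t / 2 ^ i;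
    its bound only involves the terms of the sum with index at least i. *)
Lemma trace_energy_scale (t : R) : (0 < t)%R ->
  F t <= (k_trace * t `^ gam)%:E * S t.
Proof.
move=> t0; have [i [iD bi]] := dyadic_below_diam diam0 t0.
have ti0 : (0 < t / 2 ^+ i)%R by rewrite divr_gt0 ?exprn_gt0.
have -> : F t = F (t / 2 ^+ i)%R.
  by rewrite /besov_energy; apply: eq_integral => z _; rewrite bi.
apply: le_trans (energy_bd_trace_le iso dns dbl Cmu1 p1 diam0 theta0 Ct1 reg meas_u b1 ti0 iD) _.
rewrite /k_trace -mulrA (EFinM (k_energy Cmu Ct p b) (k_sum * t `^ gam)%R).
rewrite -[leRHS]muleA lee_wpmul2l ?lee_fin ?(ltW k_energy_gt0)//.
exact: integral_weighted_osc_scale.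
Qed.

(** weighted_osc has a finite integral, hence is finite almost everywhere, and it
    is finite only at Lebesgue points. *)
Lemma scale_sum_finite_lebesgue (t : R) : (0 < t)%R -> t%:E <= 2%:E * Dm ->
  S t < +oo ->
  {ae nu, forall z, lebesgue_value iota mu p u (bdpt z) (bd_trace mu u z)}.
Proof.
move=> t0 tD Soo.
have W0 (z : boundary iota) : 0 <= W t z.
  exact: weighted_osc_ge0.
have mW : measurable_fun [set: borel z0] (W t).
  exact: (measurable_weighted_osc p iso dns dbl meas_u b1 t0).
have iW : nu.-integrable setT (W t).
  apply/integrableP; split => //.
  under eq_integral do rewrite gee0_abs//.
  have tD0 : (t / 2 ^+ 0)%:E <= 2%:E * Dm by rewrite expr0 divr1.
  have := integral_weighted_osc_scale t0 tD0; rewrite expr0 divr1 => /le_lt_trans; apply.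
  by rewrite lte_mul_pinfty// lee_fin mulr_ge0 ?powR_ge0// ltW// k_sum_gt0.
have := integrable_ae measurableT iW; apply: filterS => z /(_ I) Wz.
have Woo : W t z < +oo by rewrite ltey_eq Wz.
have [L uL _] := weighted_osc_lebesgue iso dns dbl Cmu1 p1 b1 meas_u t0 Woo.
by rewrite /bd_trace (lebesgue_value_trace iso dns dbl p1 meas_u uL).
Qed.

(** The scale t has to be at most twice the diameter, where the bound on the
    integral of weighted_osc is available. *)
Lemma besov_scale_sum_finite (q : \bar R) : 1 <= q ->
  besov_norm mu alpha p q u < +oo ->
  exists2 t, (0 < t)%R /\ t%:E <= 2%:E * Dm & S t < +oo.
Proof.
move=> q1 Noo.
have [d d0 dD] : exists2 d : R, (0 < d)%R & d%:E <= 2%:E * Dm.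
  case: (Dm) diam0 => [e e0|_|//].
    by exists e => //; rewrite -EFinM lee_fin; rewrite lte_fin in e0; lra.
  by exists 1%R => //; rewrite gt0_muley ?lte_fin ?leey.
case: q q1 Noo => [s s1 Noo|_ Noo|//].
  rewrite lee_fin in s1.
  have mE := measurable_besov_energy muB p meas_u.
  have [t /andP[t0 td] St] := scale_sum_finite mE E0 p1 k01 s1 d0 Noo.
  by exists t => //; split => //; apply: le_trans dD; rewrite lee_fin ltW.
exists d => //.
have Nf : scale_sup p alpha E \is a fin_num.
  by rewrite ge0_fin_numE// scale_sup_ge0.
have := @scale_sum_le_sup R E alpha p kap E0 p1 k01 (fine (scale_sup p alpha E)) d.
rewrite fineK// lexx => /(_ isT d0) /le_lt_trans; apply.
by rewrite ltry.
Qed.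

Definition k_besov (q : \bar R) : R :=
  match q with
  | s%:E => k_norm p kap k_trace s
  | _ => k_sup p kap k_trace
  end.

Lemma besov_norm_trace_le (q : \bar R) : 1 <= q ->
  besov_norm nu (alpha - theta / p) p q (bd_trace mu u) <=
  (k_besov q)%:E * besov_norm mu alpha p q u.
Proof.
have mE := measurable_besov_energy muB p meas_u.
have F0 t : 0 <= F t by exact: besov_energy_ge0.
case: q => [s s1|_|//].
  rewrite lee_fin in s1.
  exact: (scale_norm_le mE E0 p1 k01 F0 k_trace_gt0 trace_energy_scale s1).
exact: (scale_sup_le E0 p1 k01 F0 k_trace_gt0 trace_energy_scale).
Qed.

Lemma trace_locally_integrable (t : R) : (0 < t)%R -> S t < +oo ->
  locally_integrable_wrt nu (bd_trace mu u).
Proof.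
move=> t0 Soo; apply: (finite_energy_locally_integrable nuB p1 _ t0).
  exact: (measurable_bd_trace iso dns dbl meas_u).
apply: le_lt_trans (trace_energy_scale t0) _.
by rewrite lte_mul_pinfty// lee_fin mulr_ge0 ?powR_ge0// ltW// k_trace_gt0.
Qed.

End trace_bound.

Lemma lebesgue_value_cvg (R : realType) (X Z : metricType R) (x0 : X)
    (iota : X -> Z) (mu : {measure set (borel x0) -> \bar R}) (p : R)
    (u : X -> R) (z : Z) (L : R) :
  lebesgue_value iota mu p u z L ->
  mean_dist iota mu p u z r L @[r --> 0^'+] --> 0%E.
Proof.
move=> uL.
have near0 (d : R) : 0 < d -> \forall r \near 0^'+, 0 < r < d.
  move=> d0; near=> r; apply/andP; split; near: r.
    exact: nbhs_right_gt.
  exact: nbhs_right_lt.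
apply: cvg_EFin.
  have [d d0 h] := uL 1 ltr01; apply: filterS (near0 d d0) => r rd.
  rewrite ge0_fin_numE ?mean_dist_ge0//; exact: le_lt_trans (h r rd) (ltry _).
apply/cvgrPdist_le => /= e e0; have [d d0 h] := uL e e0.
apply: filterS (near0 d d0) => r rd.
rewrite sub0r normrN ger0_norm ?fine_ge0 ?mean_dist_ge0//.
rewrite -lee_fin fineK; first exact: h.
rewrite ge0_fin_numE ?mean_dist_ge0//; exact: le_lt_trans (h r rd) (ltry _).
Unshelve. all: by end_near. Qed.

(** * The trace theorem *)

Unset Implicit Arguments.

Theorem theorem1p1 (R : realType) (alpha p theta : R) (q : \bar R)
    (Cmu Ctheta A : R)
    (alpha_gt0 : 0 < alpha) (alpha_lt1 : alpha < 1)
    (p_ge1 : 1 <= p) (q_ge1 : (1 <= q)%E) (theta_gt0 : 0 < theta)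
    (trace_gt0 : 0 < alpha - theta / p) (trace_lt1 : alpha - theta / p < 1)
    (Cmu_ge1 : 1 <= Cmu) (Ctheta_ge1 : 1 <= Ctheta) (A_ge1 : 1 <= A) :
  exists2 C : R, 1 <= C &
    forall (Omega Omegabar : metricType R) (iota : Omega -> Omegabar)
      (x0 : Omega) (z0 : boundary iota)
      (mu : {measure set (borel x0) -> \bar R})
      (nu : {measure set (borel z0) -> \bar R}),
    locally_compact [set: Omega] ->
    ~ complete_space Omega ->
    completion_of iota ->
    doubling mu Cmu ->
    uniform_domain (range iota) A ->
    (0 < diam (~` range iota))%E ->
    codim_regular mu nu theta Ctheta ->
    exists T : (Omega -> R) -> (boundary iota -> R),
      [/\ forall u, besov mu alpha p q u ->
            besov nu (alpha - theta / p) p q (T u),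
          forall u v, besov mu alpha p q u -> besov mu alpha p q v ->
            {ae mu, forall x, u x = v x} ->
            {ae nu, forall z, T u z = T v z},
          forall (a b : R) u v,
            besov mu alpha p q u -> besov mu alpha p q v ->
            {ae nu, forall z,
              T (fun x => a * u x + b * v x) z = a * T u z + b * T v z},
          forall u, besov mu alpha p q u ->
            {ae nu, forall z,
              ((mu (bdball z r))^-1 *
                 \int[mu]_(x in bdball z r) ((`|u x - T u z| `^ p)%:E))%E
                @[r --> 0^'+] --> 0%E}
        & forall u, besov mu alpha p q u ->
            (besov_norm nu (alpha - theta / p) p q (T u)
               <= C%:E * besov_norm mu alpha p q u)%E].
Proof.
pose K := k_besov Cmu theta Ctheta alpha p q.
exists (Num.max 1 K); first by rewrite le_max lexx.
move=> X Z iota x0 z0 mu nu _ _ [_ iso dns] dbl _ diam0 reg.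
have meas_besov u : besov mu alpha p q u ->
    measurable_fun [set: borel x0] (u : borel x0 -> R) by case=> -[].
have leb u : besov mu alpha p q u -> {ae nu, forall z,
    lebesgue_value iota mu p u (bdpt z) (bd_trace mu u z)}.
  move=> /[dup] /meas_besov meas_u [_ uoo].
  have [t [t0 tD] St] := besov_scale_sum_finite dbl p_ge1 diam0
    meas_u trace_gt0 q_ge1 uoo.
  exact: (scale_sum_finite_lebesgue iso dns dbl Cmu_ge1 p_ge1 diam0 theta_gt0
    Ctheta_ge1 reg meas_u trace_gt0 t0 tD St).
have norm_le u : besov mu alpha p q u ->
    (besov_norm nu (alpha - theta / p) p q (bd_trace mu u)
      <= (Num.max 1 K)%:E * besov_norm mu alpha p q u)%E.
  move=> /meas_besov meas_u.
  apply: le_trans (besov_norm_trace_le iso dns dbl Cmu_ge1 p_ge1 diam0 theta_gt0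
    Ctheta_ge1 reg meas_u trace_gt0 q_ge1) _.
  rewrite lee_wpmul2r//; last by rewrite lee_fin le_max lexx orbT.
  case: (q) => [s| |]/=; first exact: poweR_ge0.
    exact: (scale_sup_ge0 (fun t => besov_energy mu p t u) alpha p).
  by [].
have aeF := ae_filter_ringOfSetsType nu.
exists (fun u => bd_trace mu u); split; last exact: norm_le.
- move=> u /[dup] bu [_ uoo]; have meas_u := meas_besov u bu.
  have [t [t0 _] St] := besov_scale_sum_finite dbl p_ge1 diam0
    meas_u trace_gt0 q_ge1 uoo.
  split.
    exact: (trace_locally_integrable iso dns dbl Cmu_ge1 p_ge1 diam0 theta_gt0
      Ctheta_ge1 reg meas_u trace_gt0 t0 St).
  apply: le_lt_trans (norm_le u bu) _.
  by rewrite lte_mul_pinfty// lee_fin le_max ler01.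
- move=> u v bu bv uv; have := leb u bu; apply: filterS => z uz.
  have vz := lebesgue_value_ae iso (meas_besov u bu) (meas_besov v bv) uv uz.
  by rewrite /bd_trace (lebesgue_value_trace iso dns dbl p_ge1 (meas_besov v bv) vz).
- move=> a b u v bu bv; have := leb v bv; have := leb u bu; apply: filterS2 => z uz vz.
  have wz := lebesgue_valueD iso p_ge1 a b (meas_besov u bu) (meas_besov v bv) uz vz.
  rewrite {1}/bd_trace (lebesgue_value_trace iso dns dbl p_ge1 _ wz)//.
  apply: measurable_funD; apply: measurable_funM => //; exact: meas_besov.
- move=> u bu; have := leb u bu; apply: filterS => z uz.
  exact: lebesgue_value_cvg uz.
Qed.
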